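(* Let $k\ge2$ and let $N=C_1-\dots-C_k$ be a manifold of sewed cells, where each $C_i$, $i=1,\dots,k$, is a copy of one and the same 3-dimensional almost cosymplectic manifold $M^3$ (respectively, 3-dimensional almost $\alpha$-Kenmotsu manifold $M^3$). If $M^3$ satisfies the $(\kappa_0,\mu_0,\mu_0')$-nullity condition, $(\kappa_0,\mu_0,\mu'_0)\in\mathbb{R}^3$, then the manifold $N$ of sewed cells is an almost cosymplectic manifold (respectively, an almost $(\alpha/\sqrt{k})$-Kenmotsu manifold) which satisfies the $\left(\frac{\kappa_0}{k},\frac{\mu_0}{\sqrt{k}},\frac{\mu_0'}{\sqrt{k}}\right)$-nullity condition.
   Context: An almost contact metric structure on a manifold is a quadruple $(\varphi,\xi,\eta,g)$ of a $(1,1)$-tensor field (affinor) $\varphi$, a vector field $\xi$, a one-form $\eta$ and a Riemannian metric $g$ with $\varphi^2=-Id+\eta\otimes\xi$, $\eta(\xi)=1$, $g(\varphi X,\varphi Y)=g(X,Y)-\eta(X)\eta(Y)$. Its fundamental form is $\varPhi(X,Y)=g(X,\varphi Y)$. The manifold is almost cosymplectic if $d\eta=0$ and $d\varPhi=0$; it is almost $\alpha$-Kenmotsu ($\alpha\ne0$ a real constant) if $d\eta=0$ and $d\varPhi=2\alpha\,\eta\wedge\varPhi$. Put $h=\frac12\mathcal{L}_\xi\varphi$ and $h'=h\varphi$. With $R(X,Y)Z=\nabla_X\nabla_YZ-\nabla_Y\nabla_XZ-\nabla_{[X,Y]}Z$, the manifold satisfies the $(\kappa,\mu,\mu')$-nullity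 condition, $(\kappa,\mu,\mu')\in\mathbb{R}^3$, if for all vector fields $X,Y$ $$R(X,Y)\xi=\kappa(\eta(Y)X-\eta(X)Y)+\mu(\eta(Y)hX-\eta(X)hY)+\mu'(\eta(Y)h'X-\eta(X)h'Y).$$ A cell is a 3-dimensional almost contact metric manifold $(M^3,\varphi,\xi,\eta,g)$ with $d\eta=0$. Product of cells $C_i=(M_i^3,\varphi_i,\xi_i,\eta_i,g_i)$: $M=C_1\times\dots\times C_k$ with projections $\pi_i:M\to C_i$; $D_i=\bigcap_{j\ne i}\mathrm{Ker}\,\pi_{*j}$, so $TM=D_1\oplus\dots\oplus D_k$. The lift of a vector field $X$ on $C_i$ is the unique vector field $\bar X\in\Gamma(D_i)$ with $\pi_{*i}(\bar X)=X$. $\bar\varphi_i$ is the $(1,1)$-tensor field on $M$ with $\bar\varphi_i\bar X=\overline{\varphi_iX}$ for lifts $\bar X$ of vector fields on $C_i$ and $\bar\varphi_i=0$ on $D_j$, $j\neq i$. Put $f=\sum_{i=1}^k\bar\varphi_i$, $\bar g=\sum_{i=1}^k\pi_i^*g_i$, $\bar\xi_i$ = the lift of $\xi_i$, $\bar\eta_i=\pi_i^*\eta_i$, $\bar\xi=(\bar\xi_1+\dots+\bar\xi_k)/\sqrt{k}$. The distribution $Im(f)\oplus\mathbb{R}\bar\xi$ on $M$ is involutive; the (maximal connected) integral submanifold $N\subset M$ of it through a point of $M$ is called a manifold of sewed cells, denoted $N=C_1-\dots-C_k$; with $\iota:N\to M$ the inclusion, it carries the almost contact metric structure $\varphi=f|_N$,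 $\xi=\bar\xi|_N$, $\eta=\sqrt{k}\,\iota^*\bar\eta_1$, $g=\bar g|_N$. *)

(* Defs.v *)
From HB Require Import structures.
From mathcomp Require Import all_boot all_order all_algebra.
From mathcomp Require Import all_classical all_reals all_analysis.

Set Implicit Arguments.
Unset Strict Implicit.
Unset Printing Implicit Defensive.
Import Order.TTheory GRing.Theory Num.Theory.
Import numFieldNormedType.Exports.
Local Open Scope classical_set_scope.
Local Open Scope ring_scope.

(* Smooth manifolds are given by an atlas, and a tensor field by its           *)
(* components in each chart, subject to the transformation law under changes   *)
(* of coordinates.  Tangent vectors are row vectors, on which linear maps act  *)
(* on the right: an affinor phi sends v to v *m phi, a one-form eta (a column) *)
(* sends v to v *m eta, and a bilinear form g sends (u, v) to u *m g *m v^T.   *)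

Section Smooth.
Variables (R : realType) (V W : normedModType R).

Fixpoint Ck_on (r : nat) (U : set V) (f : V -> W) : Prop :=
  match r with
  | 0 => forall x, U x -> {for x, continuous f}
  | r'.+1 => (forall x, U x -> differentiable f x) /\
             (forall v, Ck_on r' U (fun x => 'D_v f x))
  end.

Definition smooth_on (U : set V) (f : V -> W) : Prop := forall r, Ck_on r U f.

End Smooth.

Section Coordinates.
Variables (R : realType) (n : nat).
Implicit Types (u v w x : 'rV[R]_n) (X Y Z xi : 'rV[R]_n -> 'rV[R]_n).
Implicit Types (phi g : 'rV[R]_n -> 'M[R]_n) (eta : 'rV[R]_n -> 'cV[R]_n).

Definition form1 (a : 'cV[R]_n) u : R := (u *m a) 0 0.
Definition form2 (A : 'M[R]_n) u v : R := (u *m A *m v^T) 0 0.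

Definition bracket X Y : 'rV[R]_n -> 'rV[R]_n :=
  fun x => 'D_(X x) Y x - 'D_(Y x) X x.

(* The Levi-Civita connection of g: Gamma x u v is the vector such that        *)
(* 2 g(Gamma(u, v), w) = D_u g(v, w) + D_v g(u, w) - D_w g(u, v) for all w.    *)
Definition christoffel g x u v : 'rV[R]_n :=
  (\row_l (2^-1 * ('D_u (fun y => form2 (g y) v (delta_mx 0 l)) x
                 + 'D_v (fun y => form2 (g y) u (delta_mx 0 l)) x
                 - 'D_(delta_mx 0 l) (fun y => form2 (g y) u v) x)))
  *m invmx (g x).

Definition nabla g X Y : 'rV[R]_n -> 'rV[R]_n :=
  fun x => 'D_(X x) Y x + christoffel g x (X x) (Y x).

Definition curvature g X Y Z : 'rV[R]_n -> 'rV[R]_n :=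
  fun x => nabla g X (nabla g Y Z) x - nabla g Y (nabla g X Z) x
           - nabla g (bracket X Y) Z x.

Definition app phi X : 'rV[R]_n -> 'rV[R]_n := fun x => X x *m phi x.

(* h X, where h is half the Lie derivative of phi along xi                     *)
Definition half_lie xi phi X : 'rV[R]_n -> 'rV[R]_n :=
  fun x => 2^-1 *: (bracket xi (app phi X) x - app phi (bracket xi X) x).

(* Exterior derivatives and exterior product, on constant coordinate fields;   *)
(* the normalisation does not affect d Phi = 2 alpha eta /\ Phi, as the factor *)
(* 1/3 of the other usual convention occurs on both sides.                     *)
Definition ext_d1 eta x u v : R :=
  'D_u (fun y => form1 (eta y) v) x - 'D_v (fun y => form1 (eta y) u) x.

Definition ext_d2 (Phi : 'rV[R]_n -> 'rV[R]_n -> 'rV[R]_n -> R) x u v w : R :=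
  'D_u (fun y => Phi y v w) x + 'D_v (fun y => Phi y w u) x
  + 'D_w (fun y => Phi y u v) x.

Definition wedge12 (a : 'rV[R]_n -> R) (B : 'rV[R]_n -> 'rV[R]_n -> R) u v w : R :=
  a u * B v w + a v * B w u + a w * B u v.

End Coordinates.

(* param a is the inverse of coord a: dom a -> patch a, with arbitrary values  *)
(* outside patch a; coord a is likewise arbitrary outside dom a.               *)
Record atlas (R : realType) (n : nat) := Atlas {
  points :> topologicalType;
  chart : Type;
  dom : chart -> set points;
  coord : chart -> points -> 'rV[R]_n;
  param : chart -> 'rV[R]_n -> points
}.

Section Maps.
Variables (R : realType) (m n : nat) (N : atlas R m) (M : atlas R n).

Definition local_rep (F : N -> M) (a : chart N) (b : chart M) :
    'rV[R]_m -> 'rV[R]_n :=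
  fun x => coord b (F (param a x)).

Definition local_dom (F : N -> M) (a : chart N) (b : chart M) :
    set 'rV[R]_m :=
  coord a @` (dom a `&` F @^-1` dom b).

Definition differential (F : N -> M) (a : chart N) (b : chart M) (p : N) :
    'M[R]_(m, n) :=
  jacobian (local_rep F a b) (coord a p).

Definition smooth_map (F : N -> M) : Prop :=
  continuous F /\
  forall a b, smooth_on (local_dom F a b) (local_rep F a b).

End Maps.

Section Manifold.
Variables (R : realType) (n : nat) (M : atlas R n).

Definition patch (a : chart M) : set 'rV[R]_n := coord a @` dom a.

Definition manifold : Prop :=
  [/\ hausdorff_space M /\ @second_countable M,
      forall p : M, exists a, dom a p,
      forall a, open (@dom R n M a) /\ open (patch a),
      forall a p, dom a p ->
        [/\ param a (coord a p) = p :> M,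
            {for p, continuous (coord a)} &
            {for coord a p, continuous (param a : 'rV[R]_n -> M)}] &
      forall a b, smooth_on (local_dom (@idfun M) a b) (local_rep (@idfun M) a b)].

Definition change (a b : chart M) (p : M) : 'M[R]_n :=
  differential (@idfun M) a b p.

Definition field (p q : nat) := chart M -> 'rV[R]_n -> 'M[R]_(p, q).

Definition smooth_field p q (T : field p q) : Prop :=
  forall a, smooth_on (patch a) (T a).

Definition vector_field (X : field 1 n) : Prop :=
  smooth_field X /\
  forall a b p, dom a p -> dom b p ->
    X b (coord b p) = X a (coord a p) *m change a b p.

Definition one_form (eta : field n 1) : Prop :=
  smooth_field eta /\
  forall a b p, dom a p -> dom b p ->
    eta a (coord a p) = change a b p *m eta b (coord b p).

Definition affinor (phi : field n n) : Prop :=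
  smooth_field phi /\
  forall a b p, dom a p -> dom b p ->
    phi a (coord a p) *m change a b p = change a b p *m phi b (coord b p).

Definition riemannian_metric (g : field n n) : Prop :=
  [/\ smooth_field g,
      forall a b p, dom a p -> dom b p ->
        g a (coord a p) = change a b p *m g b (coord b p) *m (change a b p)^T,
      forall a x u v, patch a x -> form2 (g a x) u v = form2 (g a x) v u &
      forall a x u, patch a x -> u != 0 -> 0 < form2 (g a x) u u].

Record contact_data := ContactData {
  phi : field n n;
  xi : field 1 n;
  eta : field n 1;
  metric : field n n
}.

Variable S : contact_data.

Definition almost_contact_metric : Prop :=
  [/\ manifold,
      [/\ affinor (phi S), vector_field (xi S), one_form (eta S) &
          riemannian_metric (metric S)],
      forall a x u, patch a x ->
        u *m phi S a x *m phi S a x = - u + form1 (eta S a x) u *: xi S a x,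
      forall a x, patch a x -> form1 (eta S a x) (xi S a x) = 1 &
      forall a x u v, patch a x ->
        form2 (metric S a x) (u *m phi S a x) (v *m phi S a x) =
        form2 (metric S a x) u v - form1 (eta S a x) u * form1 (eta S a x) v].

Definition eta_closed : Prop :=
  forall a x u v, patch a x -> ext_d1 (eta S a) x u v = 0.

Definition fundamental_form (a : chart M) (x u v : 'rV[R]_n) : R :=
  form2 (metric S a x) u (v *m phi S a x).

Definition almost_cosymplectic : Prop :=
  [/\ almost_contact_metric, eta_closed &
      forall a x u v w, patch a x -> ext_d2 (fundamental_form a) x u v w = 0].

Definition almost_kenmotsu (alpha : R) : Prop :=
  [/\ alpha != 0, almost_contact_metric, eta_closed &
      forall a x u v w, patch a x ->
        ext_d2 (fundamental_form a) x u v w =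
        2 * alpha * wedge12 (form1 (eta S a x)) (fundamental_form a x) u v w].

Definition nullity (kappa mu mu' : R) : Prop :=
  forall X Y : field 1 n, vector_field X -> vector_field Y ->
  forall a x, patch a x ->
    let e := form1 (eta S a x) in
    let h := half_lie (xi S a) (phi S a) in
    let h' := fun Z => h (app (phi S a) Z) in
    curvature (metric S a) (X a) (Y a) (xi S a) x =
      kappa *: (e (Y a x) *: X a x - e (X a x) *: Y a x)
      + mu *: (e (Y a x) *: h (X a) x - e (X a x) *: h (Y a) x)
      + mu' *: (e (Y a x) *: h' (X a) x - e (X a x) *: h' (Y a) x).

End Manifold.

(* Connected integral manifolds of the distribution on M which is spanned, in  *)
(* the chart b at the point of coordinates y, by the rows of D b y.            *)
Section Integral.
Variables (R : realType) (n : nat) (M : atlas R n) (D : field M n n).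

Definition integral_manifold m (N : atlas R m) (iota : N -> M) : Prop :=
  [/\ manifold N,
      connected [set: N] /\ [set: N] !=set0,
      smooth_map iota,
      injective iota &
      forall a b p, dom a p -> dom b (iota p) ->
        row_free (differential iota a b p) /\
        (differential iota a b p == D b (coord b (iota p)))%MS].

Definition maximal_integral_manifold m (N : atlas R m) (iota : N -> M) : Prop :=
  integral_manifold iota /\
  forall (N' : atlas R m) (iota' : N' -> M), integral_manifold iota' ->
    range iota `<=` range iota' -> range iota' `<=` range iota.

End Integral.

Record cell (R : realType) := Cell {
  cell_atlas :> atlas R 3;
  cell_data : contact_data cell_atlas
}.

Definition is_cell (R : realType) (C : cell R) : Prop :=
  almost_contact_metric (cell_data C) /\ eta_closed (cell_data C).

Section SewedCells.
Variables (R : realType) (k : nat) (C : 'I_k -> cell R).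

Definition cells_dim : nat := (\sum_(i < k) 3)%N.

Definition product_of_cells : atlas R cells_dim :=
  @Atlas R cells_dim (prod_topology (fun i => points (C i)))
    (forall i, chart (C i))
    (fun c => [set p | forall i, dom (c i) (p i)])
    (fun c p => \mxrow_(i < k) coord (c i) (p i))
    (fun c x i => param (c i) (submxrow x i)).

(* In product charts the differential of pi_i is v |-> submxrow v i, with      *)
(* matrix dproj i; the lift to the product is then the transpose of dproj i.   *)
Definition dproj (i : 'I_k) : 'M[R]_(cells_dim, 3) :=
  \mxcol_(j < k) (if j == i then 1%:M else 0 : 'M[R]_3).

Notation pfield := (field product_of_cells).

Definition phi_bar (i : 'I_k) : pfield cells_dim cells_dim := fun c x =>
  dproj i *m phi (cell_data (C i)) (c i) (submxrow x i) *m (dproj i)^T.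

Definition xi_bar_ (i : 'I_k) : pfield 1 cells_dim := fun c x =>
  xi (cell_data (C i)) (c i) (submxrow x i) *m (dproj i)^T.

Definition eta_bar (i : 'I_k) : pfield cells_dim 1 := fun c x =>
  dproj i *m eta (cell_data (C i)) (c i) (submxrow x i).

Definition f_bar : pfield cells_dim cells_dim := fun c x =>
  \sum_(i < k) phi_bar i c x.

Definition g_bar : pfield cells_dim cells_dim := fun c x =>
  \sum_(i < k)
    dproj i *m metric (cell_data (C i)) (c i) (submxrow x i) *m (dproj i)^T.

Definition xi_bar : pfield 1 cells_dim := fun c x =>
  (Num.sqrt k%:R)^-1 *: \sum_(i < k) xi_bar_ i c x.

(* The row space of the matrix of an affinor is its image.                     *)
Definition sewing_distribution : pfield cells_dim cells_dim := fun c x =>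
  (f_bar c x + xi_bar c x)%MS.

(* As the differential of iota is injective, these relations determine S.      *)
Definition restricted_structure m (N : atlas R m)
    (iota : N -> product_of_cells) (S : contact_data N) : Prop :=
  forall a c p, dom a p -> dom c (iota p) ->
    let x := coord a p in
    let y := coord c (iota p) in
    let J := differential iota a c p in
    [/\ phi S a x *m J = J *m f_bar c y,
        xi S a x *m J = xi_bar c y,
        forall i : 'I_k, i = 0 :> nat ->
          eta S a x = Num.sqrt k%:R *: (J *m eta_bar i c y) &
        metric S a x = J *m g_bar c y *m J^T].

Definition sewed_cells (N : atlas R (2 * k).+1)
    (iota : N -> product_of_cells) (S : contact_data N) : Prop :=
  [/\ forall i, is_cell (C i),
      maximal_integral_manifold sewing_distribution iota &
      restricted_structure iota S].

End SewedCells.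

(* Main.v *)
(* In product charts, the inclusion of N = C_1 - ... - C_k gives maps F_i into
   the cells, with Jacobians J_i, and the tangent space of N consists of the
   families (z_i) for which eta_i(z_i) does not depend on i.  The metric, the
   form eta and the fundamental form of N are sums of pullbacks along the F_i
   (eta can be computed on each factor), so that the conditions on d eta and
   d Phi are pulled back from the cells; the factor 1/sqrt k comes from
   eta_i(u J_i) = eta(u) / sqrt k.

   The nullity condition only uses the Koszul formula: nabla of N is the
   tangential part of the pulled back connections.  As eta_i(nabla xi_i) = 0 in
   each cell, the pulled back derivative of xi is already tangent, hence
   (nabla_u xi) J_i = nabla_(u J_i) xi_i / sqrt k; differentiating this relation
   once more gives
     g(R(u, v) xi, w) = 1/sqrt k * sum_i g_i(R_i(u J_i, v J_i) xi_i, w J_i),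
   and the vector given by the nullity condition of N is the only one with
   these pairings, since h J_i = J_i h_i / sqrt k.  The nullity condition
   quantifies over global vector fields; bump functions turn it into an
   identity between tensors at each point. *)
Require Import Defs.
From HB Require Import structures.
From mathcomp Require Import all_boot all_order all_algebra.
From mathcomp Require Import all_classical all_reals all_analysis.
From mathcomp Require Import ring.
(* Again, so that [coord] is the chart map and not the one of [vector]. *)
Import Defs.

Set Implicit Arguments.
Unset Strict Implicit.
Unset Printing Implicit Defensive.
Import Order.TTheory GRing.Theory Num.Theory.
Import numFieldNormedType.Exports.
Local Open Scope classical_set_scope.
Local Open Scope ring_scope.

(** * Smooth maps *)

Section EntrywiseDerivatives.
Variables (R : realType) (V : normedModType R).

Lemma differentiable_mxP m n (f : V -> 'M[R]_(m, n)) x :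
  differentiable f x <-> forall i j, differentiable (fun y => f y i j) x.
Proof.
split=> [df i j|df].
  exact: (differentiable_comp df (differentiable_coord _ i j)).
have -> : f = \sum_i \sum_j (fun y => f y i j *: delta_mx i j).
  apply/funext => y; rewrite [LHS]matrix_sum_delta fct_sumE.
  by apply: eq_bigr => i _; rewrite fct_sumE.
by do 2!apply: differentiable_sum => ?; apply: differentiableZl.
Qed.

Lemma derive_coord m n (f : V -> 'M[R]_(m, n)) x v i j :
  differentiable f x -> 'D_v (fun y => f y i j) x = ('D_v f x) i j.
Proof.
by move=> df; rewrite derive_mx ?mxE //; exact: diff_derivable.
Qed.

Lemma derive_comp (W W' : normedModType R) (f : V -> W) (g : W -> W') x v :
  differentiable f x -> differentiable g (f x) ->
  'D_v (fun y => g (f y)) x = 'D_('D_v f x) g (f x).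
Proof.
move=> df dg; rewrite deriveE; last exact: differentiable_comp.
by rewrite (diff_comp df dg) /= -!deriveE.
Qed.

Lemma derive_near (W : normedModType R) (U : set V) (f g : V -> W) x v :
  open U -> U x -> (forall y, U y -> f y = g y) -> 'D_v f x = 'D_v g x.
Proof.
move=> oU Ux fg; apply: near_eq_derive.
by apply: filterS (open_nbhs_nbhs (conj oU Ux)) => y; apply: fg.
Qed.

(** The difference [g - f] vanishes near [x], hence is differentiable there with zero differential;
    adding it to [f] gives [g]. *)
Lemma differentiable_near (W : normedModType R) (U : set V) (f g : V -> W) x :
  open U -> U x -> (forall y, U y -> f y = g y) ->
  differentiable f x -> differentiable g x.
Proof.
move=> oU Ux fg df.
have U0 : \forall y \near (0 : V), U (y + x).
  have : \near x, U x by exact: open_nbhs_nbhs.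
  by rewrite (near_shift 0) /=; apply: filterS => y; rewrite /= subr0.
have gfE : ((g - f) \o shift x : V -> W) = cst ((g - f) x) + \0 +o_ 0 id.
  apply/eqaddoP => e e0; near=> y.
  have Uyx : U (y + x) by near: y; exact: U0.
  by rewrite /= !fctE /= !fg // addr0 !subrr normr0 mulr_ge0 // ltW.
have dgf0 := @diff_unique _ _ _ (g - f) \0 x (@cst_continuous _ _ _) gfE.
have dgf : differentiable (g - f) x.
  apply/diff_locallyP; rewrite dgf0; split=> //; exact: cst_continuous.
by rewrite -[g](subrK f); apply: differentiableD.
Unshelve. all: by end_near. Qed.

End EntrywiseDerivatives.

Section DirectionalDerivatives.
Variables (R : realType) (V W : normedModType R).
Implicit Types (f : V -> W) (u v : V).

Lemma derive_dirD f x u v : differentiable f x ->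
  'D_(u + v) f x = 'D_u f x + 'D_v f x.
Proof. by move=> df; rewrite !deriveE // linearD. Qed.

Lemma derive_dirZ f x (a : R) v : differentiable f x ->
  'D_(a *: v) f x = a *: 'D_v f x.
Proof. by move=> df; rewrite !deriveE // linearZ. Qed.

Lemma derive_dir_sum n (f : 'rV[R]_n -> W) (x v : 'rV[R]_n) : differentiable f x ->
  'D_v f x = \sum_j v 0 j *: 'D_(delta_mx 0 j) f x.
Proof.
move=> df; rewrite deriveE // [in LHS](row_sum_delta v) linear_sum.
by apply: eq_bigr => j _; rewrite linearZ deriveE.
Qed.

End DirectionalDerivatives.

(** * Stability of [Ck_on] on an open set under algebra and composition *)

Section Smoothness.
Variables (R : realType) (V : normedModType R) (U : set V).
Hypothesis oU : open U.

(** As [U] is open, equality on [U] is equality near each of its points, so it passes to the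
    derivatives of every order. *)
Lemma Ck_on_eq (W : normedModType R) r (f g : V -> W) :
  (forall x, U x -> f x = g x) -> Ck_on r U f -> Ck_on r U g.
Proof.
elim: r f g => [|r IH] f g fg /=.
  move=> fc x Ux; rewrite /prop_for /continuous_at -(fg x Ux).
  apply: cvg_trans (fc x Ux); apply: near_eq_cvg.
  by apply: filterS (open_nbhs_nbhs (conj oU Ux)) => y; apply: fg.
move=> [df Df]; split=> [x Ux|v]; first exact: differentiable_near fg (df x Ux).
by apply: IH (Df v) => x Ux; apply: derive_near fg.
Qed.

Lemma Ck_on_pred (W : normedModType R) r (f : V -> W) :
  Ck_on r.+1 U f -> Ck_on r U f.
Proof.
elim: r f => [|r IH] f [df Df]; first by move=> x /df/differentiable_continuous.
by split=> // v; apply: IH.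
Qed.

Lemma Ck_on_cst (W : normedModType R) r (a : W) : Ck_on r U (fun=> a).
Proof.
elim: r a => [|r IH] a /=; first by move=> x _; apply: cst_continuous.
split=> [x _|v]; first exact: differentiable_cst.
have -> : (fun x => 'D_v (fun=> a : W) x) = fun=> 0 :> W; last exact: IH.
by apply/funext => x; rewrite derive_cst.
Qed.

Lemma Ck_onD (W : normedModType R) r (f g : V -> W) :
  Ck_on r U f -> Ck_on r U g -> Ck_on r U (fun x => f x + g x).
Proof.
elim: r f g => [|r IH] f g /=.
  by move=> fc gc x Ux; apply: continuousD; [apply: fc|apply: gc].
move=> [df Df] [dg Dg]; split=> [x Ux|v].
  by apply: differentiableD; [apply: df|apply: dg].
apply: Ck_on_eq (IH _ _ (Df v) (Dg v)) => x Ux.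
by rewrite deriveD //; apply: diff_derivable; [apply: df|apply: dg].
Qed.

Lemma Ck_onM r (f g : V -> R) :
  Ck_on r U f -> Ck_on r U g -> Ck_on r U (fun x => f x * g x).
Proof.
elim: r f g => [|r IH] f g.
  by move=> fc gc x Ux; apply: continuousM; [apply: fc|apply: gc].
move=> fr gr; case: (fr) (gr) => [df Df] [dg Dg]; split=> [x Ux|v].
  by apply: differentiableM; [apply: df|apply: dg].
have fgv := Ck_onD (IH _ _ (Ck_on_pred fr) (Dg v)) (IH _ _ (Ck_on_pred gr) (Df v)).
apply: Ck_on_eq fgv => x Ux.
by rewrite deriveM //; apply: diff_derivable; [apply: df|apply: dg].
Qed.

Lemma Ck_on_sum I (s : seq I) (P : pred I) (W : normedModType R) r
    (f : I -> V -> W) :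
  (forall i, P i -> Ck_on r U (f i)) ->
  Ck_on r U (fun x => \sum_(i <- s | P i) f i x).
Proof.
move=> fr; pose F := \sum_(i <- s | P i) f i.
rewrite (_ : (fun x => _) = F); last by apply/funext => x; rewrite /F fct_sumE.
rewrite /F; elim/big_rec: _ => [|i g Pi gr]; first exact: Ck_on_cst.
by apply: Ck_onD => //; apply: fr.
Qed.

Lemma Ck_on_prod I (s : seq I) (P : pred I) r (f : I -> V -> R) :
  (forall i, P i -> Ck_on r U (f i)) ->
  Ck_on r U (fun x => \prod_(i <- s | P i) f i x).
Proof.
move=> fr; pose F := \prod_(i <- s | P i) f i.
rewrite (_ : (fun x => _) = F); last by apply/funext => x; rewrite /F fct_prodE.
rewrite /F; elim/big_rec: _ => [|i g Pi gr]; first exact: Ck_on_cst.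
by apply: Ck_onM => //; apply: fr.
Qed.

(** The derivative of 1/f is -(1/f)^2 f', which involves 1/f only at the lower order given by the
    induction. *)
Lemma Ck_onV r (f : V -> R) : (forall x, U x -> f x != 0) ->
  Ck_on r U f -> Ck_on r U (fun x => (f x)^-1).
Proof.
move=> f0; elim: r => [|r IH].
  by move=> fc x Ux; apply: continuousV; [apply: f0|apply: fc].
move=> fr; case: (fr) => [df Df]; split=> [x Ux|v].
  by apply: differentiableV; [apply: df|apply: f0].
have fV := IH (Ck_on_pred fr).
have := Ck_onM (@Ck_on_cst R r (-1)) (Ck_onM (Ck_onM fV fV) (Df v)).
apply: Ck_on_eq => x Ux; rewrite deriveV ?f0 //; last exact/diff_derivable/df.
by rewrite mulN1r -expr2 exprVn scaleNr.
Qed.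

Lemma Ck_on_mxP r m n (f : V -> 'M[R]_(m, n)) :
  Ck_on r U f <-> forall i j, Ck_on r U (fun x => f x i j).
Proof.
split.
  elim: r f => [|r IH] f.
    move=> fc i j x Ux.
    by apply: (@continuous_comp _ _ _ f (fun M => M i j));
      [exact: fc|exact: coord_continuous].
  move=> [df Df] i j; split=> [x Ux|v].
    exact: ((differentiable_mxP _ _).1 (df x Ux)).
  by apply: Ck_on_eq (IH _ (Df v) i j) => x Ux; rewrite derive_coord //; apply: df.
elim: r f => [|r IH] f fij.
  move=> x Ux.
  rewrite (_ : f = fun x => \sum_i \sum_j f x i j *: delta_mx i j); last first.
    by apply/funext => y; rewrite [LHS]matrix_sum_delta.
  apply: (@Ck_on_sum _ _ _ _ 0%N) (Ux) => i _.
  apply: (@Ck_on_sum _ _ _ _ 0%N) => j _ y Uy.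
  by apply: continuousZr_tmp; exact: fij.
split=> [x Ux|v].
  by apply/differentiable_mxP => i j; case: (fij i j) => + _; apply.
apply: IH => i j; case: (fij i j) => df; move/(_ v).
apply: Ck_on_eq => x Ux; rewrite derive_coord //.
by apply/differentiable_mxP => i' j'; case: (fij i' j') => + _; apply.
Qed.

(** [Ck_on] controls derivatives in constant directions, whereas the chain rule produces the
    derivative of [g] in the direction ['D_v F x], which varies with [x]. It is therefore expanded
    over the basis, and the induction applies to the partial derivatives of [g]. *)
Lemma Ck_on_comp r n (P : set 'rV[R]_n) (F : V -> 'rV[R]_n) (g : 'rV[R]_n -> R) :
  (forall x, U x -> P (F x)) -> Ck_on r U F -> Ck_on r P g ->
  Ck_on r U (fun x => g (F x)).
Proof.
move=> UP; elim: r g => [|r IH] g.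
  move=> Fc gc x Ux; apply: continuous_comp; first exact: Fc.
  by apply: gc; apply: UP.
move=> Fr gr; case: (Fr) (gr) => [dF DF] [dg Dg]; split=> [x Ux|v].
  by apply: differentiable_comp; [apply: dF|apply/dg/UP].
suff : Ck_on r U (fun x => \sum_j 'D_v F x 0 j * 'D_(delta_mx 0 j) g (F x)).
  apply: Ck_on_eq => x Ux; rewrite (@derive_comp _ _ _ _ F g); [|exact: dF|exact/dg/UP].
  by rewrite derive_dir_sum //; apply/dg/UP.
apply: Ck_on_sum => j _; apply: Ck_onM; first exact: ((Ck_on_mxP _ _).1 (DF v) 0 j).
exact: (IH _ (Ck_on_pred Fr) (Dg (delta_mx 0 j))).
Qed.

End Smoothness.

(** * Symmetry of second derivatives *)

Section Schwarz.
Variables (R : realType) (V : normedModType R).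

Lemma derive_translate (W : normedModType R) (f : V -> W) (a x u : V) :
  differentiable f (x + a) ->
  differentiable (fun y => f (y + a)) x /\
  'D_u (fun y => f (y + a)) x = 'D_u f (x + a).
Proof.
move=> df; have sE : (fun y => y + a) = id + cst a :> (V -> V).
  by apply/funext => y; rewrite fctE.
have ds : differentiable (fun y => y + a) x.
  by rewrite sE; apply: differentiableD => //; exact: differentiable_cst.
split; first exact: (differentiable_comp ds df).
rewrite (derive_comp _ ds df) sE deriveD ?derive_id ?derive_cst ?addr0 //.
Qed.

Lemma MVT_line (f : V -> R) (x u : V) (s : R) : 0 < s ->
  (forall t, 0 <= t <= s -> differentiable f (x + t *: u)) ->
  exists2 t, 0 <= t <= s & f (x + s *: u) - f x = s * 'D_u f (x + t *: u).
Proof.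
move=> s0 df; pose l (t : R) : V := x + t *: u.
have lE : l = cst x + ( *:%R ^~ u) by apply/funext => t; rewrite fctE.
have dl t : differentiable l t.
  by rewrite lE; apply: differentiableD; first exact: differentiable_cst.
have Dl t : 'D_1 l t = u.
  have dZ : differentiable (fun t : R => t *: u) t by [].
  rewrite lE deriveD ?derive_cst ?add0r ?(deriveE _ dZ) ?diff_val ?scale1r //.
  exact: diff_derivable.
have dfl t : 0 <= t <= s -> is_derive t 1 (f \o l) ('D_u f (l t)).
  move=> /df dft; apply: DeriveDef; first exact/diff_derivable/differentiable_comp.
  by rewrite derive_comp // Dl.
have [||t] := MVT s0 (f := f \o l) (df := fun t => 'D_u f (l t)).
- by move=> t; rewrite in_itv /= => /andP[t0 ts]; apply: dfl; rewrite !ltW.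
- apply: derivable_within_continuous => t; rewrite in_itv /= => ts.
  by have [] := dfl t ts.
rewrite in_itv /= => /andP[t0 ts] fE; exists t; first by rewrite !ltW.
by move: fE; rewrite /= subr0 mulrC /l scale0r addr0 => ->.
Qed.

(** The mean value theorem is applied twice: along [u] to the increment of [f] by [s *: v], then
    along [v] to ['D_u f]. *)
Lemma second_difference (f : V -> R) (x u v : V) (s : R) (U : set V) : 0 < s ->
  (forall a b, 0 <= a <= s -> 0 <= b <= s -> U (x + a *: u + b *: v)) ->
  smooth_on U f ->
  exists a b, [/\ 0 <= a <= s, 0 <= b <= s &
    f (x + s *: u + s *: v) - f (x + s *: u) - f (x + s *: v) + f x =
    s * (s * 'D_v (fun y => 'D_u f y) (x + a *: u + b *: v))].
Proof.
move=> s0 Us fU; pose f2 y := f (y + s *: v) - f y.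
have [df _] := fU 1%N; have [_ /(_ u)[dDf _]] := fU 2%N.
have s00 : 0 <= (0 : R) <= s by rewrite lexx ltW.
have ss : 0 <= s <= s by rewrite lexx ltW.
have Us0 a : 0 <= a <= s -> U (x + a *: u).
  by move=> /Us /(_ s00); rewrite scale0r addr0.
have df2 a : 0 <= a <= s -> differentiable f2 (x + a *: u) /\
    'D_u f2 (x + a *: u) = 'D_u f (x + a *: u + s *: v) - 'D_u f (x + a *: u).
  move=> as0; have [d1 D1] := derive_translate u (df _ (Us _ _ as0 ss)).
  have d2 := df _ (Us0 _ as0).
  split; first exact: differentiableB.
  by rewrite deriveB ?D1 //; exact: diff_derivable.
have [a as0 fE] := MVT_line s0 (fun a as0 => (df2 a as0).1).
rewrite (df2 a as0).2 in fE.
have [b bs0 DfE] := MVT_line s0 (fun b bs0 => dDf _ (Us _ _ as0 bs0)).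
exists a, b; split=> //; rewrite -DfE -fE /f2.
by rewrite opprB addrA addrAC.
Qed.

Lemma eq_of_values_nearby (f g : V -> R) (x : V) :
  {for x, continuous f} -> {for x, continuous g} ->
  (forall e, 0 < e -> exists y z, [/\ ball x e y, ball x e z & f y = g z]) ->
  f x = g x.
Proof.
move=> fc gc fg; apply/eqP; rewrite -subr_eq0 -normr_le0 leNgt; apply/negP => d0.
have d20 : 0 < `|f x - g x| / 2 by rewrite divr_gt0.
have /nbhs_ballP[e e0 eE] : \forall y \near x,
    `|f x - f y| < `|f x - g x| / 2 /\ `|g x - g y| < `|f x - g x| / 2.
  have n1 := (cvgrPdist_lt _ _).1 fc _ d20.
  have n2 := (cvgrPdist_lt _ _).1 gc _ d20.
  near=> y; split; near: y; [exact: n1|exact: n2].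
have [y [z [/eE[fy _] /eE[_ gz] fygz]]] := fg e e0.
have := ler_distD (f y) (f x) (g x).
by rewrite leNgt [X in _ < X]splitr ltrD // fygz distrC.
Unshelve. all: by end_near. Qed.

(** The second difference of [f] is symmetric in [u] and [v]. Divided by s^2, it is a value of
    either mixed derivative at a point close to [x], and both are continuous at [x]. *)
Lemma Schwarz (U : set V) (f : V -> R) (x u v : V) : open U -> U x ->
  smooth_on U f -> 'D_u (fun y => 'D_v f y) x = 'D_v (fun y => 'D_u f y) x.
Proof.
move=> oU Ux fU.
have [_ /(_ v)[_ /(_ u)Duvc]] := fU 2%N; have [_ /(_ u)[_ /(_ v)Dvuc]] := fU 2%N.
apply: (eq_of_values_nearby (Duvc x Ux) (Dvuc x Ux)) => e0 e00.
have [e [e_gt0 eU ee0]] : exists e, [/\ 0 < e, ball x e `<=` U & e <= e0].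
  have /nbhs_ballP[d /= d0 dU] := open_nbhs_nbhs (conj oU Ux).
  exists (Num.min d e0); rewrite lt_min d0 e00 ge_min lexx orbT; split=> //.
  by apply: subset_trans dU; apply: le_ball; rewrite ge_min lexx.
(* This size keeps the parallelogram spanned by [s *: u] and [s *: v] inside the ball of radius [e];
   the summand 1 makes the denominator positive. *)
pose s := e / (`|u| + `|v| + 1).
have s0 : 0 < s by rewrite divr_gt0 // ltr_wpDl // addr_ge0.
have box (w1 w2 : V) a b : `|w1| + `|w2| = `|u| + `|v| ->
    0 <= a <= s -> 0 <= b <= s -> ball x e (x + a *: w1 + b *: w2).
  move=> w12 /andP[a0 la] /andP[b0 lb]; rewrite -ball_normE /= -addrA opprD addNKr.
  rewrite normrN (le_lt_trans (ler_normD _ _)) // !normrZ !ger0_norm //.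
  apply: (@le_lt_trans _ _ (s * (`|u| + `|v|))).
    by rewrite -w12 mulrDr lerD // ler_wpM2r.
  by rewrite /s mulrAC ltr_pdivrMr ?ltr_wpDl ?addr_ge0 // ltr_pM2l // ltrDl.
have [a [b [as0 bs0 E1]]] := second_difference s0
  (fun a b ha hb => eU _ (box u v a b erefl ha hb)) fU.
have [c [d [cs0 ds0 E2]]] := second_difference s0
  (fun a b ha hb => eU _ (box v u a b (addrC _ _) ha hb)) fU.
exists (x + c *: v + d *: u), (x + a *: u + b *: v); split.
- by apply: le_ball ee0 _ _; apply: box => //; exact: addrC.
- by apply: le_ball ee0 _ _; apply: box.
have sn : s != 0 by rewrite gt_eqF.
apply: (mulfI sn); apply: (mulfI sn).
rewrite -[LHS]E2 -[RHS]E1 [x + s *: v + s *: u]addrAC.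
by rewrite [_ - f (x + s *: v) - _]addrAC.
Qed.

End Schwarz.

(** * Smooth matrix-valued maps *)

Section SmoothMatrices.
Variables (R : realType) (V : normedModType R) (U : set V).
Hypothesis oU : open U.

Lemma smooth_on_differentiable (W : normedModType R) (f : V -> W) x :
  smooth_on U f -> U x -> differentiable f x.
Proof. by move=> /(_ 1%N)[df _] /df. Qed.

Lemma smooth_on_derive (W : normedModType R) (f : V -> W) v :
  smooth_on U f -> smooth_on U (fun x => 'D_v f x).
Proof. by move=> fU r; have [_ /(_ v)] := fU r.+1. Qed.

Lemma smooth_on_eq (W : normedModType R) (f g : V -> W) :
  (forall x, U x -> f x = g x) -> smooth_on U f -> smooth_on U g.
Proof. by move=> fg fU r; apply: Ck_on_eq (fU r). Qed.

Lemma smooth_on_mxP m n (f : V -> 'M[R]_(m, n)) :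
  smooth_on U f <-> forall i j, smooth_on U (fun x => f x i j).
Proof.
split=> [fU i j r|fU r]; first exact: ((Ck_on_mxP oU _ _).1 (fU r)).
by apply/(Ck_on_mxP oU) => i j; apply: fU.
Qed.

Lemma smooth_on_cst (W : normedModType R) (a : W) : smooth_on U (fun=> a).
Proof. by move=> r; apply: Ck_on_cst. Qed.

Lemma smooth_onD (W : normedModType R) (f g : V -> W) :
  smooth_on U f -> smooth_on U g -> smooth_on U (fun x => f x + g x).
Proof. by move=> fU gU r; apply: Ck_onD. Qed.

Lemma smooth_onM (f g : V -> R) :
  smooth_on U f -> smooth_on U g -> smooth_on U (fun x => f x * g x).
Proof. by move=> fU gU r; apply: Ck_onM. Qed.

Lemma smooth_on_sum I (s : seq I) (P : pred I) (W : normedModType R)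
    (f : I -> V -> W) :
  (forall i, P i -> smooth_on U (f i)) ->
  smooth_on U (fun x => \sum_(i <- s | P i) f i x).
Proof. by move=> fU r; apply: Ck_on_sum => // i Pi; apply: fU. Qed.

Lemma smooth_on_prod I (s : seq I) (P : pred I) (f : I -> V -> R) :
  (forall i, P i -> smooth_on U (f i)) ->
  smooth_on U (fun x => \prod_(i <- s | P i) f i x).
Proof. by move=> fU r; apply: Ck_on_prod => // i Pi; apply: fU. Qed.

Lemma smooth_onV (f : V -> R) : (forall x, U x -> f x != 0) ->
  smooth_on U f -> smooth_on U (fun x => (f x)^-1).
Proof. by move=> f0 fU r; apply: Ck_onV. Qed.

Lemma smooth_on_mulmx m n p (f : V -> 'M[R]_(m, n)) (g : V -> 'M[R]_(n, p)) :
  smooth_on U f -> smooth_on U g -> smooth_on U (fun x => f x *m g x).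
Proof.
move=> /smooth_on_mxP fU /smooth_on_mxP gU; apply/smooth_on_mxP => i j.
rewrite (_ : (fun x => _) = fun x => \sum_l f x i l * g x l j); last first.
  by apply/funext => x; rewrite mxE.
by apply: smooth_on_sum => l _; apply: smooth_onM.
Qed.

Lemma smooth_on_trmx m n (f : V -> 'M[R]_(m, n)) :
  smooth_on U f -> smooth_on U (fun x => (f x)^T).
Proof.
move=> /smooth_on_mxP fU; apply/smooth_on_mxP => i j.
by rewrite (_ : (fun x => _) = fun x => f x j i) //; apply/funext => x; rewrite mxE.
Qed.

Lemma smooth_onZ m n (a : V -> R) (f : V -> 'M[R]_(m, n)) :
  smooth_on U a -> smooth_on U f -> smooth_on U (fun x => a x *: f x).
Proof.
move=> aU /smooth_on_mxP fU; apply/smooth_on_mxP => i j.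
rewrite (_ : (fun x => _) = fun x => a x * f x i j); first exact: smooth_onM.
by apply/funext => x; rewrite mxE.
Qed.

Lemma smooth_on_det n (f : V -> 'M[R]_n) :
  smooth_on U f -> smooth_on U (fun x => \det (f x)).
Proof.
move=> /smooth_on_mxP fU; apply: smooth_on_sum => s _.
apply: smooth_onM; first exact: smooth_on_cst.
by apply: smooth_on_prod => i _; apply: fU.
Qed.

(** Cramer's formula: the inverse is the adjugate over the determinant, and the cofactors are
    determinants of submatrices. *)
Lemma smooth_on_invmx n (f : V -> 'M[R]_n) :
  (forall x, U x -> f x \in unitmx) ->
  smooth_on U f -> smooth_on U (fun x => invmx (f x)).
Proof.
move=> fu fU; apply: (@smooth_on_eq _ (fun x => (\det (f x))^-1 *: \adj (f x))).
  by move=> x Ux; rewrite /invmx fu.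
apply: smooth_onZ; first apply: smooth_onV.
- by move=> x /fu; rewrite unitmxE unitfE.
- exact: smooth_on_det.
apply/smooth_on_mxP => i j; pose s := (-1) ^+ (j + i) : R.
rewrite (_ : (fun x => _) = fun x => s * \det (row' j (col' i (f x)))); last first.
  by apply/funext => x; rewrite mxE.
apply: smooth_onM; first exact: smooth_on_cst.
apply: smooth_on_det; apply/smooth_on_mxP => k l.
rewrite (_ : (fun x => _) = fun x => f x (lift j k) (lift i l)); last first.
  by apply/funext => x; rewrite !mxE.
exact: ((smooth_on_mxP _).1 fU).
Qed.

Lemma smooth_on_comp m n p (P : set 'rV[R]_n) (F : V -> 'rV[R]_n)
    (g : 'rV[R]_n -> 'M[R]_(m, p)) : open P -> (forall x, U x -> P (F x)) ->
  smooth_on U F -> smooth_on P g -> smooth_on U (fun x => g (F x)).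
Proof.
move=> oP UP FU gP r; apply/Ck_on_mxP => // i j.
exact: (Ck_on_comp oU UP (FU r) ((Ck_on_mxP oP _ _).1 (gP r) i j)).
Qed.

End SmoothMatrices.

(** Serves for tensors on a patch which have a manageable expression only on overlaps with other
    charts, the overlap depending on the point. *)
Lemma smooth_on_local (R : realType) (V W : normedModType R) (U : set V)
    (f : V -> W) :
  (forall x, U x -> exists B, [/\ open B, B x & smooth_on B f]) ->
  smooth_on U f.
Proof.
move=> fU r; elim: r f fU => [|r IH] f fU.
  by move=> x /fU[B [_ Bx /(_ 0%N)]]; apply.
split=> [x /fU[B [_ Bx fB]]|v]; first exact: smooth_on_differentiable fB Bx.
apply: IH => x /fU[B [oB Bx fB]]; exists B; split=> //.
exact: smooth_on_derive.
Qed.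

(** * Leibniz rules for matrix products *)

Section MatrixDerivatives.
Variables (R : realType) (V : normedModType R).

Lemma derive_mulmx m n p (f : V -> 'M[R]_(m, n)) (g : V -> 'M[R]_(n, p)) x v :
  differentiable f x -> differentiable g x ->
  differentiable (fun y => f y *m g y) x /\
  'D_v (fun y => f y *m g y) x = 'D_v f x *m g x + f x *m 'D_v g x.
Proof.
move=> df dg.
have dfij := (differentiable_mxP _ _).1 df.
have dgij := (differentiable_mxP _ _).1 dg.
have fgE i j : (fun y => (f y *m g y) i j) =
    \sum_l ((fun y => f y i l) * (fun y => g y l j)).
  by apply/funext => y; rewrite mxE fct_sumE.
have dfg : differentiable (fun y => f y *m g y) x.
  apply/differentiable_mxP => i j; rewrite fgE; apply: differentiable_sum => l.
  exact: differentiableM.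
split=> //; apply/matrixP => i j; rewrite -derive_coord // fgE.
rewrite derive_sum => [|l]; last by apply/diff_derivable/differentiableM.
rewrite !mxE -big_split /=; apply: eq_bigr => l _.
rewrite deriveM; [|exact: diff_derivable|exact: diff_derivable].
by rewrite !derive_coord // addrC; congr (_ + _); rewrite mulrC.
Qed.

Lemma derive_trmx m n (f : V -> 'M[R]_(m, n)) x v : differentiable f x ->
  differentiable (fun y => (f y)^T) x /\
  'D_v (fun y => (f y)^T) x = ('D_v f x)^T.
Proof.
move=> df.
have fE i j : (fun y => (f y)^T i j) = fun y => f y j i.
  by apply/funext => y; rewrite mxE.
have dfT : differentiable (fun y => (f y)^T) x.
  by apply/differentiable_mxP => i j; rewrite fE; exact: ((differentiable_mxP _ _).1 df).
split=> //; apply/matrixP => i j.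
by rewrite -derive_coord // fE derive_coord // mxE.
Qed.

Lemma derive_big_sum (W : normedModType R) n (f : 'I_n -> V -> W) x v :
  (forall i, differentiable (f i) x) ->
  differentiable (fun y => \sum_i f i y) x /\
  'D_v (fun y => \sum_i f i y) x = \sum_i 'D_v (f i) x.
Proof.
move=> df; rewrite (_ : (fun y => _) = \sum_i f i); last first.
  by apply/funext => y; rewrite fct_sumE.
split; first exact: differentiable_sum.
by apply: derive_sum => i; apply: diff_derivable.
Qed.

Lemma derive_mulmxl m n p (A : 'M[R]_(m, n)) (g : V -> 'M[R]_(n, p)) x v :
  differentiable g x ->
  differentiable (fun y => A *m g y) x /\
  'D_v (fun y => A *m g y) x = A *m 'D_v g x.
Proof.
move=> dg; have [d ->] := derive_mulmx v (differentiable_cst A x) dg.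
by split=> //; rewrite derive_cst mul0mx add0r.
Qed.

Lemma derive_mulmxr m n p (f : V -> 'M[R]_(m, n)) (A : 'M[R]_(n, p)) x v :
  differentiable f x ->
  differentiable (fun y => f y *m A) x /\
  'D_v (fun y => f y *m A) x = 'D_v f x *m A.
Proof.
move=> df; have [d ->] := derive_mulmx v df (differentiable_cst A x).
by split=> //; rewrite derive_cst mulmx0 addr0.
Qed.

Lemma derive_scale (W : normedModType R) (a : R) (f : V -> W) x v :
  differentiable f x ->
  differentiable (fun y => a *: f y) x /\ 'D_v (fun y => a *: f y) x = a *: 'D_v f x.
Proof.
move=> df; split; first exact: differentiableZ.
by rewrite -deriveZ //; exact: diff_derivable.
Qed.

End MatrixDerivatives.

(** * Jacobians and the symmetry of the Hessian *)

Section Jacobians.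
Variables (R : realType) (m n : nat) (U : set 'rV[R]_m) (F : 'rV[R]_m -> 'rV[R]_n).
Hypotheses (oU : open U) (FU : smooth_on U F).

Lemma mul_jacobian x v : U x -> v *m jacobian F x = 'D_v F x.
Proof. by move=> Ux; rewrite -deriveEjacobian //; apply: smooth_on_differentiable Ux. Qed.

Lemma smooth_on_jacobian : smooth_on U (jacobian F).
Proof.
apply/smooth_on_mxP => // i j.
apply: (@smooth_on_eq _ _ _ oU _ (fun x => 'D_(delta_mx 0 i) F x 0 j)).
  by move=> x Ux; rewrite -mul_jacobian // -rowE mxE.
exact: ((smooth_on_mxP oU _).1 (smooth_on_derive _ FU)).
Qed.

(** Both sides are second derivatives of [F], and Schwarz's theorem applies to each coordinate. This
    Hessian appears whenever a tensor pulled back along [F] is differentiated. *)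
Lemma derive_jacobian_sym x u v : U x ->
  u *m 'D_v (jacobian F) x = v *m 'D_u (jacobian F) x.
Proof.
move=> Ux; have dJ := smooth_on_differentiable smooth_on_jacobian Ux.
have uvE (w z : 'rV_m) : w *m 'D_z (jacobian F) x = 'D_z (fun y => 'D_w F y) x.
  have [_ <-] := derive_mulmxl w z dJ.
  by apply: derive_near Ux _ => // y Uy; rewrite mul_jacobian.
rewrite !uvE; apply/rowP => j.
have dD w : differentiable (fun y => 'D_w F y) x.
  by apply: smooth_on_differentiable Ux; exact: smooth_on_derive.
have [Fj FjU DFjE] : exists2 Fj : 'rV_m -> R, smooth_on U Fj &
    forall w z, ('D_z (fun y => 'D_w F y) x) 0 j = 'D_z (fun y => 'D_w Fj y) x.
  exists (fun y => F y 0 j); first exact: ((smooth_on_mxP oU _).1 FU 0 j).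
  move=> w z.
  rewrite -(derive_coord _ _ _ (dD w)); apply: derive_near Ux _ => // y Uy.
  by rewrite (derive_coord _ _ _ (smooth_on_differentiable FU Uy)).
exact: etrans (DFjE u v) (etrans (Schwarz v u oU Ux FjU) (esym (DFjE v u))).
Qed.

End Jacobians.

(** * The flat function exp(-1/t) and its derivatives *)

Section FlatFunction.
Variable R : realType.

(** The functions t^(-n) exp(-1/t), extended by 0 to t <= 0: their linear combinations are stable
    under differentiation. The bump functions use n = 0. *)
Definition flat n (t : R) : R :=
  if 0 < t then t^-1 ^+ n * expR (- t^-1) else 0.

(** The exponential of 1/t dominates the term of degree n + 2 of its series. The factor [t ^+ 2]
    makes the difference quotient at 0 tend to 0. *)
Lemma flat_le n t : 0 < t -> flat n t <= t ^+ 2 * (n.+2)`!%:R.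
Proof.
move=> t0; have t'0 : 0 < t^-1 by rewrite invr_gt0.
rewrite /flat t0 expRN ler_pdivrMr ?expR_gt0 //.
have h : t^-1 ^+ n.+2 <= (n.+2)`!%:R * expR t^-1.
  rewrite mulrC -ler_pdivrMr ?ltr0n ?fact_gt0 //.
  by apply: le_trans (expR_ge1Dxn n.+1 (ltW t'0)); rewrite lerDr.
rewrite (_ : t^-1 ^+ n = t ^+ 2 * t^-1 ^+ n.+2); last first.
  by rewrite -[n.+2]addn2 exprD mulrCA -exprMn divff ?gt_eqF // expr1n mulr1.
by rewrite -[leRHS]mulrA ler_wpM2l // exprn_ge0 // ltW.
Qed.

Lemma is_derive_flat (n : nat) (t : R) :
  is_derive t (1 : R) (flat n) (flat n.+2 t - n%:R * flat n.+1 t).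
Proof.
have [t0|t0|t0] := ltrgtP t 0.
- have -> : flat n.+2 t - n%:R * flat n.+1 t = 0.
    by rewrite /flat ltNge (ltW t0) /= mulr0 subr0.
  apply: near_eq_is_derive (is_derive_cst (0 : R) t (1 : R)).
  near=> y; rewrite /flat ltNge ltW //.
  by near: y; exact: lt_nbhsl.
- apply: (@near_eq_is_derive _ _ _
      ((fun y => y^-1) ^+ n * (expR \o (fun y => - y^-1)))).
    near=> y; rewrite /flat ifT //; first by rewrite fctE /= exprfctE.
    by near: y; exact: lt_nbhsr.
  have dV : is_derive t 1 (fun y : R => y^-1) (- t ^- 2).
    apply: is_derive_eq; first by apply: is_deriveV; rewrite gt_eqF.
    by rewrite scaler1.
  have dN : is_derive t 1 (fun y : R => - y^-1) (t ^- 2).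
    by rewrite -[t ^- 2]opprK; exact: is_deriveN.
  have dE := @is_derive1_comp _ expR (fun y : R => - y^-1) _ _ _
    (is_derive_expR (- t^-1)) dN.
  apply: is_derive_eq; rewrite /flat t0 exprfctE /=.
  case: n => [|n].
    by rewrite expr0 !mul0r scale0r scaler0 addr0 subr0 scale1r exprVn mulrC.
  by rewrite -exprVn /GRing.scale /= !exprS; ring.
- have -> : flat n.+2 t - n%:R * flat n.+1 t = 0.
    by rewrite /flat t0 ltxx mulr0 subr0.
  rewrite t0.
  (* At 0 the quotient vanishes on the left, and by [flat_le] it is at most h times a factorial on
     the right. *)
  have fl : (fun h : R => h^-1 *: ((flat n \o shift 0) (h *: 1) - flat n 0)) @ 0^'
      --> (0 : R).
    apply/cvgr0Pnorm_le => e e0; near=> h.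
    rewrite /= addr0 [h *: 1]mulr1 [flat n 0]/flat ltxx subr0 normrM normfV.
    have [h0|h0] := ltP 0 h; last by rewrite /flat ltNge h0 normr0 mulr0 ltW.
    rewrite [`|flat _ _|]ger0_norm; last first.
      by rewrite /flat h0 mulr_ge0 ?expR_ge0 // exprn_ge0 // invr_ge0 ltW.
    rewrite gtr0_norm // mulrC ler_pdivrMr //.
    apply: le_trans (flat_le n h0) _; rewrite expr2 -mulrA mulrC ler_pM2r //.
    rewrite -ler_pdivlMr ?ltr0n ?fact_gt0 // -[leLHS]gtr0_norm //.
    by near: h; apply: dnbhs0_le; rewrite divr_gt0 // ltr0n fact_gt0.
  by apply: DeriveDef; [apply/cvg_ex; exists 0|apply/cvg_lim].
Unshelve. all: by end_near. Qed.

(** The induction on [r] is uniform in [n], since differentiating [flat n] brings in [flat n.+1] and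
    [flat n.+2]. *)
Lemma Ck_on_flat (V : normedModType R) (U : set V) r n (f : V -> R) : open U ->
  Ck_on r U f -> Ck_on r U (fun x => flat n (f x)).
Proof.
move=> oU; have dflat k t : differentiable (flat k) t.
  by apply/derivable1_diffP; have [] := is_derive_flat k t.
have Dflat k t v : 'D_v (flat k) t = v * (flat k.+2 t - k%:R * flat k.+1 t).
  have := derive_dirZ v (1 : R) (dflat k t).
  by rewrite [v *: _]mulr1 (@derive_val _ _ _ _ _ _ _ (is_derive_flat k t)).
elim: r n f => [|r IH] n f.
  move=> fc x Ux; apply: continuous_comp; first exact: fc.
  exact: differentiable_continuous.
move=> fr; case: (fr) => [df Df]; split=> [x Ux|v].
  by apply: differentiable_comp; first exact: df.
have fr' := Ck_on_pred fr.
have fk k := IH k f fr'.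
have nk : Ck_on r U (fun x => (- n%:R : R) * flat n.+1 (f x)).
  by apply: Ck_onM => //; exact: Ck_on_cst.
have := Ck_onM oU (Df v) (Ck_onD oU (fk n.+2) nk).
apply: Ck_on_eq => // x Ux.
by rewrite (derive_comp _ (df x Ux) (dflat n _)) Dflat mulNr.
Qed.

Lemma smooth_on_flat (V : normedModType R) (U : set V) n (f : V -> R) : open U ->
  smooth_on U f -> smooth_on U (fun x => flat n (f x)).
Proof. by move=> oU fU r; apply: Ck_on_flat. Qed.

End FlatFunction.

(** * The Levi-Civita connection in coordinates *)

Local Opaque derive.

Section BilinearForms.
Variables (R : realType) (n : nat).
Implicit Types (A B : 'M[R]_n) (u v w : 'rV[R]_n) (a : R).

Lemma form2Dl A u v w : form2 A (u + v) w = form2 A u w + form2 A v w.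
Proof. by rewrite /form2 !mulmxDl mxE. Qed.

Lemma form2Dr A u v w : form2 A u (v + w) = form2 A u v + form2 A u w.
Proof. by rewrite /form2 linearD mulmxDr mxE. Qed.

Lemma form2Zl A a u v : form2 A (a *: u) v = a * form2 A u v.
Proof. by rewrite /form2 -!scalemxAl mxE. Qed.

Lemma form2Zr A a u v : form2 A u (a *: v) = a * form2 A u v.
Proof. by rewrite /form2 linearZ /= -scalemxAr mxE. Qed.

Lemma form2Nl A u v : form2 A (- u) v = - form2 A u v.
Proof. by rewrite -scaleN1r form2Zl mulN1r. Qed.

Lemma form2Nr A u v : form2 A u (- v) = - form2 A u v.
Proof. by rewrite -scaleN1r form2Zr mulN1r. Qed.

Lemma form20l A u : form2 A 0 u = 0.
Proof. by rewrite /form2 !mul0mx mxE. Qed.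

Lemma form2_sumr A m u (v : 'I_m -> 'rV_n) :
  form2 A u (\sum_i v i) = \sum_i form2 A u (v i).
Proof. by rewrite /form2 linear_sum mulmx_sumr summxE. Qed.

Lemma form2Dm A B u v : form2 (A + B) u v = form2 A u v + form2 B u v.
Proof. by rewrite /form2 mulmxDr mulmxDl mxE. Qed.

Lemma form2Zm a A u v : form2 (a *: A) u v = a * form2 A u v.
Proof. by rewrite /form2 -scalemxAr -scalemxAl mxE. Qed.

Lemma form2_summ m (A : 'I_m -> 'M[R]_n) u v :
  form2 (\sum_i A i) u v = \sum_i form2 (A i) u v.
Proof. by rewrite /form2 mulmx_sumr mulmx_suml summxE. Qed.

Lemma form2_pullback m (J : 'M[R]_(m, n)) A (K : 'M[R]_(m, n)) (u v : 'rV[R]_m) :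
  form2 (J *m A *m K^T) u v = form2 A (u *m J) (v *m K).
Proof. by rewrite /form2 trmx_mul !mulmxA. Qed.

Lemma form2_mulr A B u v : form2 (A *m B^T) u v = form2 A u (v *m B).
Proof. by rewrite /form2 trmx_mul !mulmxA. Qed.

Lemma form1D (e : 'cV[R]_n) u v : form1 e (u + v) = form1 e u + form1 e v.
Proof. by rewrite /form1 mulmxDl mxE. Qed.

Lemma form1Z (e : 'cV[R]_n) a u : form1 e (a *: u) = a * form1 e u.
Proof. by rewrite /form1 -scalemxAl mxE. Qed.

Lemma form10 (e : 'cV[R]_n) : form1 e 0 = 0.
Proof. by rewrite /form1 mul0mx mxE. Qed.

Lemma form2E A u v : form2 A u v = (u *m A *m v^T) 0 0.
Proof. by []. Qed.

Definition form2_nondegenerate A : Prop :=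
  forall u, (forall w, form2 A u w = 0) -> u = 0.

Lemma nondegenerate_inj A u v : form2_nondegenerate A ->
  (forall w, form2 A u w = form2 A v w) -> u = v.
Proof.
move=> nA uv; apply/subr0_eq/nA => w.
by rewrite form2Dl form2Nl uv subrr.
Qed.

Lemma nondegenerate_pos A :
  (forall u, u != 0 -> 0 < form2 A u u) -> form2_nondegenerate A.
Proof.
move=> A0 u u0; apply/eqP/negPn/negP => /A0.
by rewrite u0 ltxx.
Qed.

Lemma row_free_kernel m (A : 'M[R]_(n, m)) :
  (forall u, u *m A = 0 -> u = 0) -> row_free A.
Proof.
move=> A0; rewrite -kermx_eq0; apply/eqP/row_matrixP => i.
by rewrite row0; apply: A0; rewrite -row_mul mulmx_ker row0.
Qed.

Lemma nondegenerate_unitmx A : form2_nondegenerate A -> A \in unitmx.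
Proof.
move=> nA; rewrite -row_free_unit; apply: row_free_kernel => u uA.
by apply: nA => w; rewrite /form2 uA mul0mx mxE.
Qed.

End BilinearForms.

Section FormDerivatives.
Variables (R : realType) (V : normedModType R) (n : nat).

Lemma derive_form2 (A : V -> 'M[R]_n) x z u v : differentiable A x ->
  'D_z (fun y => form2 (A y) u v) x = form2 ('D_z A x) u v.
Proof.
move=> dA; have [d1 D1] := derive_mulmxl u z dA.
have [d2 D2] := derive_mulmxr v^T z d1.
by rewrite /form2 (derive_coord _ _ _ d2) D2 D1.
Qed.

Lemma derive_form1 (e : V -> 'cV[R]_n) x z u : differentiable e x ->
  'D_z (fun y => form1 (e y) u) x = form1 ('D_z e x) u.
Proof.
move=> de; have [d1 D1] := derive_mulmxl u z de.
by rewrite /form1 (derive_coord _ _ _ d1) D1.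
Qed.

Lemma smooth_on_form2 (U : set V) (A : V -> 'M[R]_n) (u v : V -> 'rV[R]_n) :
  open U -> smooth_on U A -> smooth_on U u -> smooth_on U v ->
  smooth_on U (fun y => form2 (A y) (u y) (v y)).
Proof.
move=> oU AU uU vU; apply: ((smooth_on_mxP oU _).1 _ 0 0).
apply: smooth_on_mulmx => //; first exact: smooth_on_mulmx.
exact: smooth_on_trmx.
Qed.

End FormDerivatives.

Local Opaque form2.

(** * Koszul formula, covariant derivative and curvature *)

Section LeviCivita.
Variables (R : realType) (n : nat) (P : set 'rV[R]_n) (g : 'rV[R]_n -> 'M[R]_n).
Hypotheses (oP : open P) (gP : smooth_on P g).
Hypothesis g_sym : forall x u v, P x -> form2 (g x) u v = form2 (g x) v u.
Hypothesis g_nondeg : forall x, P x -> form2_nondegenerate (g x).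
Implicit Types (u v w x : 'rV[R]_n) (X Y xi : 'rV[R]_n -> 'rV[R]_n).

Let dg x : P x -> differentiable g x.
Proof. exact: smooth_on_differentiable. Qed.

Lemma smooth_on_christoffel (u : 'rV[R]_n) (xi : 'rV[R]_n -> 'rV[R]_n) :
  smooth_on P xi -> smooth_on P (fun x => christoffel g x u (xi x)).
Proof.
move=> xiP; apply: smooth_on_mulmx => //; last first.
  by apply: smooth_on_invmx => // x Px; exact/nondegenerate_unitmx/g_nondeg.
have gD z := smooth_on_derive z gP.
have cP a := @smooth_on_cst _ _ P _ a.
apply/smooth_on_mxP => // i l; rewrite ord1; apply: (@smooth_on_eq _ _ _ oP _
  (fun x => 2^-1 * (form2 ('D_u g x) (xi x) (delta_mx 0 l)
    + \sum_j xi x 0 j * form2 ('D_(delta_mx 0 j) g x) u (delta_mx 0 l)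
    + -1 * form2 ('D_(delta_mx 0 l) g x) u (xi x)))).
  move=> x Px; rewrite mxE !(derive_form2 _ _ _ (dg Px)).
  rewrite (derive_dir_sum (xi x) (dg Px)) form2_summ mulN1r.
  by congr (_ * (_ + _ + _)); apply: eq_bigr => j _; rewrite form2Zm.
apply: smooth_onM => //; apply: smooth_onD => //.
  apply: smooth_onD => //; first exact: smooth_on_form2.
  apply: smooth_on_sum => // j _; apply: smooth_onM => //.
    exact: ((smooth_on_mxP oP _).1 xiP).
  exact: smooth_on_form2.
by apply: smooth_onM => //; exact: smooth_on_form2.
Qed.

(** The form [t] stands for the derivative of the metric at [x]. With the Koszul formula written in
    terms of an abstract [t], identities about Christoffel symbols, once paired with a vector [w],
    become ring identities. *)
Lemma metric_derivative x : P x ->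
  exists t : 'rV[R]_n -> 'rV[R]_n -> 'rV[R]_n -> R,
  [/\ forall z a b, form2 ('D_z g x) a b = t z a b,
      (forall a b w, form2 (g x) (christoffel g x a b) w =
        2^-1 * (t a b w + t b a w - t w a b)),
      (forall z z' a b, t (z + z') a b = t z a b + t z' a b) /\
      (forall c z a b, t (c *: z) a b = c * t z a b),
      (forall z a a' b, t z (a + a') b = t z a b + t z a' b) /\
      (forall c z a b, t z (c *: a) b = c * t z a b) &
      forall z a b, t z a b = t z b a].
Proof.
move=> Px; have [t tF] : exists t : 'rV[R]_n -> 'rV[R]_n -> 'rV[R]_n -> R,
  forall z a b, form2 ('D_z g x) a b = t z a b by exists (fun z => form2 ('D_z g x)).
have tE z a b : 'D_z (fun y => form2 (g y) a b) x = t z a b.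
  by rewrite (derive_form2 _ _ _ (dg Px)) tF.
exists t; split=> //.
- move=> a b w; rewrite form2E /christoffel mulmxKV; last first.
    exact/nondegenerate_unitmx/g_nondeg.
  (* [christoffel] is defined by its pairings with basis vectors; expanding [w] over the basis gives
     the Koszul formula for every [w]. *)
  have tl y z : t w y z = \sum_l w 0 l * t (delta_mx 0 l) y z.
    rewrite -tF (derive_dir_sum w (dg Px)) form2_summ.
    by apply: eq_bigr => l _; rewrite form2Zm tF.
  have tr y z : t y z w = \sum_l w 0 l * t y z (delta_mx 0 l).
    rewrite -tF [in LHS](row_sum_delta w) form2_sumr.
    by apply: eq_bigr => l _; rewrite form2Zr tF.
  rewrite mxE tl !tr -sumrN -!big_split mulr_sumr; apply: eq_bigr => l _.
  by rewrite !mxE !tE /=; ring.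
- split=> [z z' a b|c z a b]; rewrite -!tF.
    by rewrite (derive_dirD _ _ (dg Px)) form2Dm.
  by rewrite (derive_dirZ _ _ (dg Px)) form2Zm.
- by split=> *; rewrite -!tF ?form2Dl ?form2Zl.
- move=> z a b; rewrite -!tE.
  by apply: derive_near oP Px _ => y Py; apply: g_sym.
Qed.

Local Opaque christoffel.

Lemma christoffelC x u v : P x -> christoffel g x u v = christoffel g x v u.
Proof.
move=> Px; apply: nondegenerate_inj (g_nondeg Px) _ => w.
have [t [_ tE _ _ tC]] := metric_derivative Px.
move: (christoffel g x) tE => Gamma tE.
by rewrite !tE (tC w) [t u v w + _]addrC.
Qed.

Lemma christoffelDl x u u' v : P x ->
  christoffel g x (u + u') v = christoffel g x u v + christoffel g x u' v.
Proof.
move=> Px; apply: nondegenerate_inj (g_nondeg Px) _ => w.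
have [t [_ tE [tD _] [tD' _] _]] := metric_derivative Px.
move: (christoffel g x) tE => Gamma tE.
by rewrite form2Dl !tE !tD !tD'; ring.
Qed.

Lemma christoffelZl x a u v : P x ->
  christoffel g x (a *: u) v = a *: christoffel g x u v.
Proof.
move=> Px; apply: nondegenerate_inj (g_nondeg Px) _ => w.
have [t [_ tE [_ tZ] [_ tZ'] _]] := metric_derivative Px.
move: (christoffel g x) tE => Gamma tE.
by rewrite form2Zl !tE !tZ !tZ'; ring.
Qed.

Lemma christoffel_suml x m (u : 'I_m -> 'rV_n) v : P x ->
  christoffel g x (\sum_i u i) v = \sum_i christoffel g x (u i) v.
Proof.
move=> Px; elim/big_ind2: _ => // [|a b c d <- <-]; last exact: christoffelDl.
by have := christoffelZl 0 0 v Px; rewrite !scale0r.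
Qed.

(** Compatibility of the connection with the metric: in the Koszul formula for the pairing of
    Gamma(z, xi) with xi, the last two terms cancel. *)
Lemma derive_metric_pairing x z (xi : 'rV[R]_n -> 'rV[R]_n) : P x ->
  differentiable xi x ->
  'D_z (fun y => form2 (g y) (xi y) (xi y)) x =
  2 * form2 (g x) ('D_z xi x + christoffel g x z (xi x)) (xi x).
Proof.
move=> Px dxi; have [t [tF tE _ _ tC]] := metric_derivative Px.
have [d1 D1] := derive_mulmx z dxi (dg Px).
have [dT DT] := derive_trmx z dxi; have [d2 D2] := derive_mulmx z d1 dT.
rewrite [LHS](derive_coord z 0 0 d2) D2 D1 DT mulmxDl.
rewrite [LHS]mxE [X in X + _]mxE -!form2E [X in _ + X](g_sym _ _ Px).
by rewrite [X in _ + X + _]tF form2Dl tE; field.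
Qed.

(* The matrix of the endomorphism [u |-> nabla_u xi].                          *)
Definition covariant_mx (xi : 'rV[R]_n -> 'rV[R]_n) x : 'M[R]_n :=
  \matrix_i ('D_(delta_mx 0 i) xi x + christoffel g x (delta_mx 0 i) (xi x)).

Lemma mul_covariant_mx xi x u : P x -> differentiable xi x ->
  u *m covariant_mx xi x = 'D_u xi x + christoffel g x u (xi x).
Proof.
move=> Px dxi; rewrite mulmx_sum_row (derive_dir_sum u dxi).
rewrite [u in christoffel _ _ u](row_sum_delta u) christoffel_suml // -big_split.
by apply: eq_bigr => i _; rewrite rowK christoffelZl // scalerDr.
Qed.

Lemma smooth_on_covariant_mx xi :
  smooth_on P xi -> smooth_on P (covariant_mx xi).
Proof.
move=> xiP; apply/smooth_on_mxP => // i l.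
have := smooth_onD oP (smooth_on_derive (delta_mx 0 i) xiP)
  (smooth_on_christoffel (delta_mx 0 i) xiP).
move=> /(smooth_on_mxP oP)/(_ 0 l); apply: smooth_on_eq => // x Px.
by rewrite /covariant_mx [RHS]mxE.
Qed.

(** This is nabla_u (nabla_v xi) - nabla_v (nabla_u xi) for [u] and [v] extended as constant
    coordinate fields, whose bracket vanishes. *)
Definition curvature_at xi x u v : 'rV[R]_n :=
  let A := covariant_mx xi in
  v *m 'D_u A x - u *m 'D_v A x
  + christoffel g x u (v *m A x) - christoffel g x v (u *m A x).

(** The terms in which [X] and [Y] are differentiated add up to nabla of xi along the bracket, which
    the curvature subtracts. *)
Lemma curvature_tensor X Y xi x : P x -> smooth_on P xi ->
  differentiable X x -> differentiable Y x ->
  curvature g X Y xi x = curvature_at xi x (X x) (Y x).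
Proof.
move=> Px xiP dX dY; have dxi := smooth_on_differentiable xiP.
have nE Z y : P y -> nabla g Z xi y = Z y *m covariant_mx xi y.
  by move=> Py; rewrite mul_covariant_mx //; exact: dxi.
have dA := smooth_on_differentiable (smooth_on_covariant_mx xiP) Px.
have nnE Z Z' : differentiable Z' x -> nabla g Z (nabla g Z' xi) x =
    'D_(Z x) Z' x *m covariant_mx xi x + Z' x *m 'D_(Z x) (covariant_mx xi) x
    + christoffel g x (Z x) (Z' x *m covariant_mx xi x).
  move=> dZ'; rewrite [LHS]/nabla nE //; congr (_ + _).
  have [_ <-] := derive_mulmx (Z x) dZ' dA.
  by apply: derive_near oP Px _ => y; exact: nE.
rewrite /curvature !nnE // nE // /bracket mulmxBl /curvature_at /=.
set a := 'D_(X x) Y x *m _; set b := 'D_(Y x) X x *m _.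
set c := Y x *m 'D_(X x) _ _; set d := X x *m 'D_(Y x) _ _.
set e := christoffel g x (X x) _; set f := christoffel g x _ _.
clearbody a b c d e f; by apply/rowP => j; rewrite !mxE; ring.
Qed.

End LeviCivita.

(** * The tensor h in coordinates *)

Section LieDerivative.
Variables (R : realType) (n : nat) (P : set 'rV[R]_n).
Variables (xi : 'rV[R]_n -> 'rV[R]_n) (phi : 'rV[R]_n -> 'M[R]_n).
Hypotheses (oP : open P) (xiP : smooth_on P xi) (phiP : smooth_on P phi).
Implicit Types X : 'rV[R]_n -> 'rV[R]_n.

Definition half_lie_mx x : 'M[R]_n :=
  2^-1 *: ('D_(xi x) phi x - phi x *m jacobian xi x + jacobian xi x *m phi x).

(** The derivative of [X] along [xi], followed by [phi], occurs in both brackets and cancels. *)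
Lemma half_lie_tensor X x : P x -> differentiable X x ->
  half_lie xi phi X x = X x *m half_lie_mx x.
Proof.
move=> Px dX; have dphi := smooth_on_differentiable phiP Px.
have [_ D1] := derive_mulmx (xi x) dX dphi.
rewrite /half_lie /half_lie_mx /app /bracket D1 -(mul_jacobian xiP _ Px).
rewrite -(mul_jacobian xiP _ Px) -scalemxAr; congr (_ *: _).
rewrite !mulmxDr mulmxN !mulmxBl !mulmxA.
by apply/rowP => j; rewrite !mxE; ring.
Qed.

End LieDerivative.

(** * Almost contact metric structures on open sets *)

Section ContactPatch.
Variables (R : realType) (n : nat).

(** The structure in one chart, on an arbitrary open set: it is used on full patches of the cells
    and on those parts of a patch of N that [iota] sends into one product chart. *)
Record contact_on (P : set 'rV[R]_n) (phi : 'rV[R]_n -> 'M[R]_n)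
    (xi : 'rV[R]_n -> 'rV[R]_n) (eta : 'rV[R]_n -> 'cV[R]_n)
    (g : 'rV[R]_n -> 'M[R]_n) : Prop := ContactOn {
  contact_open : open P;
  contact_phi : smooth_on P phi;
  contact_xi : smooth_on P xi;
  contact_eta : smooth_on P eta;
  contact_metric : smooth_on P g;
  contact_sym : forall x u v, P x -> form2 (g x) u v = form2 (g x) v u;
  contact_pos : forall x u, P x -> u != 0 -> 0 < form2 (g x) u u;
  contact_phi2 : forall x u, P x ->
    u *m phi x *m phi x = - u + form1 (eta x) u *: xi x;
  contact_eta_xi : forall x, P x -> form1 (eta x) (xi x) = 1;
  contact_compat : forall x u v, P x ->
    form2 (g x) (u *m phi x) (v *m phi x) =
    form2 (g x) u v - form1 (eta x) u * form1 (eta x) v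
}.

Variables (P : set 'rV[R]_n) (phi : 'rV[R]_n -> 'M[R]_n).
Variables (xi : 'rV[R]_n -> 'rV[R]_n) (eta : 'rV[R]_n -> 'cV[R]_n).
Variables (g : 'rV[R]_n -> 'M[R]_n).
Hypothesis C : contact_on P phi xi eta g.
Implicit Types u v x : 'rV[R]_n.

Lemma contact_nondegenerate x : P x -> form2_nondegenerate (g x).
Proof. by move=> Px; apply: nondegenerate_pos => u; apply: contact_pos C _ _ Px. Qed.

(** As phi^2 xi = 0, the formula for phi^2 at phi xi gives phi xi = a xi with a = eta(phi xi); then
    a^2 xi = phi^2 xi = 0 forces a = 0. *)
Lemma contact_xi_phi x : P x -> xi x *m phi x = 0.
Proof.
move=> Px; pose a := form1 (eta x) (xi x *m phi x).
have h0 : xi x *m phi x *m phi x = 0.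
  by rewrite (contact_phi2 C) // (contact_eta_xi C) // scale1r addNr.
have h1 : xi x *m phi x = a *: xi x.
  apply/esym/eqP; rewrite -subr_eq0 addrC -(contact_phi2 C) //.
  by rewrite h0 mul0mx.
have h2 : (a * a) *: xi x = 0 by rewrite -scalerA -h1 scalemxAl -h1 h0.
have a0 : a = 0.
  have := congr1 (form1 (eta x)) h2; rewrite form1Z form10 (contact_eta_xi C) //.
  by rewrite mulr1 => /eqP; rewrite mulf_eq0 orbb => /eqP.
by rewrite h1 a0 scale0r.
Qed.

(** Computing phi^3 u in two ways leaves eta(phi u) xi = 0. *)
Lemma contact_eta_phi x u : P x -> form1 (eta x) (u *m phi x) = 0.
Proof.
move=> Px; have := contact_phi2 C (u *m phi x) Px.
rewrite [u *m phi x *m phi x](contact_phi2 C) // mulmxDl mulNmx.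
rewrite -scalemxAl contact_xi_phi //.
rewrite scaler0 addr0 => /eqP; rewrite -subr_eq0 opprD opprK addrA addNr add0r.
rewrite oppr_eq0 => /eqP/(congr1 (form1 (eta x))).
by rewrite form1Z (contact_eta_xi C) // mulr1 form10.
Qed.

Lemma contact_eta_metric x u : P x -> form1 (eta x) u = form2 (g x) u (xi x).
Proof.
move=> Px; have := contact_compat C u (xi x) Px.
rewrite contact_xi_phi // -[0](scale0r (0 : 'rV_n)) form2Zr mul0r.
by rewrite (contact_eta_xi C) // mulr1 => /esym/eqP; rewrite subr_eq0 => /eqP.
Qed.

(** Compatibility of the metric with phi, applied to [u] and phi v, followed by the formula for
    phi^2. *)
Lemma contact_fundamental_antisym x u v : P x ->
  form2 (g x) u (v *m phi x) = - form2 (g x) v (u *m phi x).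
Proof.
move=> Px; rewrite [in RHS](contact_sym C) //.
have := contact_compat C u (v *m phi x) Px.
rewrite contact_eta_phi // mulr0 subr0 => <-.
rewrite (contact_phi2 C) // form2Dr form2Nr form2Zr -contact_eta_metric //.
by rewrite contact_eta_phi // mulr0 addr0.
Qed.

(** The function g(xi, xi) is constantly 1, so metric compatibility makes nabla_u xi orthogonal to
    xi. This is the source of tangency to N in [sewn_covariant]. *)
Lemma contact_covariant_eta x u : P x ->
  form1 (eta x) (u *m covariant_mx g xi x) = 0.
Proof.
move=> Px; have oP := contact_open C; have gP := contact_metric C.
have dxi := smooth_on_differentiable (contact_xi C) Px.
rewrite (mul_covariant_mx oP gP (contact_sym C) contact_nondegenerate) //.
rewrite contact_eta_metric //.
have := derive_metric_pairing oP gP (contact_sym C) contact_nondegenerate u Px dxi.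
have -> : 'D_u (fun y => form2 (g y) (xi y) (xi y)) x = 'D_u (cst (1 : R)) x.
  apply: derive_near oP Px _ => y Py.
  by rewrite -contact_eta_metric // (contact_eta_xi C).
rewrite derive_cst => /esym/eqP; rewrite mulf_eq0 pnatr_eq0 => /eqP.
by [].
Qed.

End ContactPatch.

(** * Derivatives of pulled back tensors *)

Section Pullback.
Variables (R : realType) (m n : nat) (U : set 'rV[R]_m) (Q : set 'rV[R]_n).
Variable F : 'rV[R]_m -> 'rV[R]_n.
Hypotheses (oU : open U) (oQ : open Q) (FU : smooth_on U F).
Hypothesis UQ : forall x, U x -> Q (F x).
Implicit Types (x u v w z : 'rV[R]_m).

Let J x : 'M[R]_(m, n) := jacobian F x.

Lemma differentiable_jacobian x : U x -> differentiable J x.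
Proof. exact: smooth_on_differentiable (smooth_on_jacobian oU FU). Qed.

Lemma derive_along p q (A : 'rV[R]_n -> 'M[R]_(p, q)) x z : U x ->
  differentiable A (F x) ->
  differentiable (fun y => A (F y)) x /\
  'D_z (fun y => A (F y)) x = 'D_(z *m J x) A (F x).
Proof.
move=> Ux dA; have dF := smooth_on_differentiable FU Ux.
split; first exact: (differentiable_comp dF dA).
by rewrite (derive_comp _ dF dA) (mul_jacobian FU _ Ux).
Qed.

Lemma derive_pullback2 (A : 'rV[R]_n -> 'M[R]_n) x z u v : U x ->
  smooth_on Q A ->
  form2 ('D_z (fun y => J y *m A (F y) *m (J y)^T) x) u v =
  form2 (A (F x)) (u *m 'D_z J x) (v *m J x)
  + form2 ('D_(z *m J x) A (F x)) (u *m J x) (v *m J x)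
  + form2 (A (F x)) (u *m J x) (v *m 'D_z J x).
Proof.
move=> Ux AQ; have dJ := differentiable_jacobian Ux.
have [dA DA] := derive_along z Ux (smooth_on_differentiable AQ (UQ Ux)).
have [d1 D1] := derive_mulmx z dJ dA; have [dT DT] := derive_trmx z dJ.
have [_ ->] := derive_mulmx z d1 dT.
by rewrite D1 DT DA mulmxDl !form2Dm !form2_pullback.
Qed.

Lemma derive_pullback1 (e : 'rV[R]_n -> 'cV[R]_n) x z u : U x ->
  smooth_on Q e ->
  form1 ('D_z (fun y => J y *m e (F y)) x) u =
  form1 (e (F x)) (u *m 'D_z J x) + form1 ('D_(z *m J x) e (F x)) (u *m J x).
Proof.
move=> Ux eQ; have dJ := differentiable_jacobian Ux.
have [de De] := derive_along z Ux (smooth_on_differentiable eQ (UQ Ux)).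
have [_ ->] := derive_mulmx z dJ de.
by rewrite De /form1 mulmxDr !mulmxA mxE.
Qed.

Lemma smooth_on_along p q (A : 'rV[R]_n -> 'M[R]_(p, q)) :
  smooth_on Q A -> smooth_on U (fun y => A (F y)).
Proof. exact: smooth_on_comp UQ FU. Qed.

End Pullback.

(* The right-hand side of the nullity condition, with [H] the matrix of [h]. *)
Definition nullity_at (R : realType) n (kappa mu mu' : R) (eta : 'cV[R]_n)
    (phi H : 'M[R]_n) (u v : 'rV[R]_n) : 'rV[R]_n :=
  kappa *: (form1 eta v *: u - form1 eta u *: v)
  + mu *: (form1 eta v *: (u *m H) - form1 eta u *: (v *m H))
  + mu' *: (form1 eta v *: (u *m phi *m H) - form1 eta u *: (v *m phi *m H)).

(** * Local geometry of a manifold of sewed cells *)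

Section SewnPatch.
Variables (R : realType) (m n k : nat) (i0 : 'I_k) (s : R).
Variables (U : set 'rV[R]_m) (Q : 'I_k -> set 'rV[R]_n).
Variable F : 'I_k -> 'rV[R]_m -> 'rV[R]_n.
Variables (phi_ g_ : 'I_k -> 'rV[R]_n -> 'M[R]_n) (xi_ : 'I_k -> 'rV[R]_n -> 'rV[R]_n)
  (eta_ : 'I_k -> 'rV[R]_n -> 'cV[R]_n).
Variables (phi g : 'rV[R]_m -> 'M[R]_m) (xi : 'rV[R]_m -> 'rV[R]_m)
  (eta : 'rV[R]_m -> 'cV[R]_m).
Implicit Types (x u v w z : 'rV[R]_m) (i j : 'I_k).

Notation J i x := (jacobian (F i) x).

(* [F i] is the local expression of the i-th component of the immersion of a
   manifold of sewed cells; [sewn_tangent_eta] and [sewn_tangent_surj] say that its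
   tangent spaces consist of the families [z] with [eta_i (z_i)] independent
   of [i]. *)
Record sewn_patch : Prop := SewnPatch {
  sewn_scale_gt0 : 0 < s;
  sewn_scale2 : s ^+ 2 = k%:R;
  sewn_open : open U;
  sewn_smooth : forall i, smooth_on U (F i);
  sewn_maps : forall i x, U x -> Q i (F i x);
  sewn_cells_contact :
    forall i, contact_on (Q i) (phi_ i) (xi_ i) (eta_ i) (g_ i);
  sewn_phi : forall i x, U x -> phi x *m J i x = J i x *m phi_ i (F i x);
  sewn_xi : forall i x, U x -> xi x *m J i x = s^-1 *: xi_ i (F i x);
  sewn_eta : forall x, U x -> eta x = s *: (J i0 x *m eta_ i0 (F i0 x));
  sewn_metric : forall x, U x ->
    g x = \sum_i J i x *m g_ i (F i x) *m (J i x)^T;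
  sewn_tangent_eta : forall i x u, U x ->
    form1 (eta_ i (F i x)) (u *m J i x) = form1 (eta_ i0 (F i0 x)) (u *m J i0 x);
  sewn_tangent_inj : forall x u, U x -> (forall i, u *m J i x = 0) -> u = 0;
  sewn_tangent_surj : forall x (z : 'I_k -> 'rV[R]_n) (a : R), U x ->
    (forall i, form1 (eta_ i (F i x)) (z i) = a) ->
    exists w, forall i, w *m J i x = z i
}.

Hypothesis SP : sewn_patch.

Let s_gt0 := sewn_scale_gt0 SP.
Let s2 := sewn_scale2 SP.
Let oU := sewn_open SP.
Let FU := sewn_smooth SP.
Let UQ := sewn_maps SP.
Let C := sewn_cells_contact SP.
Let phiE := sewn_phi SP.
Let xiE := sewn_xi SP.
Let etaE0 := sewn_eta SP.
Let gE := sewn_metric SP.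
Let tangent_eta := sewn_tangent_eta SP.
Let tangent_inj := sewn_tangent_inj SP.
Let tangent_surj := sewn_tangent_surj SP.

Let s_neq0 : s != 0. Proof. by rewrite gt_eqF. Qed.
Let oQ i : open (Q i). Proof. exact: contact_open (C i). Qed.
Let JU i : smooth_on U (jacobian (F i)).
Proof. exact: smooth_on_jacobian oU (FU i). Qed.
Let dJ i x : U x -> differentiable (jacobian (F i)) x.
Proof. exact: smooth_on_differentiable (JU i). Qed.

Let along p q i (A : 'rV[R]_n -> 'M[R]_(p, q)) :
  smooth_on (Q i) A -> smooth_on U (fun y => A (F i y)).
Proof. by apply: smooth_on_along => // x; apply: UQ. Qed.

Let etaE i x u : U x ->
  form1 (eta x) u = s * form1 (eta_ i (F i x)) (u *m J i x).
Proof.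
move=> Ux; rewrite etaE0 // tangent_eta // /form1 -scalemxAr mxE.
by rewrite mulmxA.
Qed.

Let form2gE x u v : U x ->
  form2 (g x) u v = \sum_i form2 (g_ i (F i x)) (u *m J i x) (v *m J i x).
Proof.
move=> Ux; rewrite gE // form2_summ; apply: eq_bigr => i _.
exact: form2_pullback.
Qed.

Let g_sym x u v : U x -> form2 (g x) u v = form2 (g x) v u.
Proof.
move=> Ux; rewrite !form2gE //; apply: eq_bigr => i _.
by apply: contact_sym (C i) _ _ _ (UQ i Ux).
Qed.

(** A sum of nonnegative terms vanishes only if all of them do; then every [u *m J i x] is zero and
    [tangent_inj] applies. *)
Let g_pos x u : U x -> u != 0 -> 0 < form2 (g x) u u.
Proof.
move=> Ux u0; rewrite form2gE // lt_neqAle eq_sym; apply/andP.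
have ge0 i : 0 <= form2 (g_ i (F i x)) (u *m J i x) (u *m J i x).
  have [->|uJ0] := eqVneq (u *m J i x) 0; first by rewrite form20l.
  by apply/ltW/(contact_pos (C i)) => //; exact: UQ.
split; last exact: sumr_ge0.
apply: contraNneq u0 => /eqP.
rewrite psumr_eq0 // => /allP sum0; apply/eqP/(tangent_inj Ux) => i.
apply/eqP/negPn/negP => /(contact_pos (C i) (UQ i Ux)).
by rewrite (eqP (implyP (sum0 i (mem_index_enum i)) isT)) ltxx.
Qed.

Let g_nondeg x : U x -> form2_nondegenerate (g x).
Proof. by move=> Ux; apply: nondegenerate_pos => u; apply: g_pos. Qed.

Let g_smooth : smooth_on U g.
Proof.
apply: (smooth_on_eq oU (fun x Ux => esym (gE Ux))).
apply: smooth_on_sum => // i _; apply: smooth_on_mulmx => //; last first.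
  exact: smooth_on_trmx.
by apply: smooth_on_mulmx => //; apply: along; exact: contact_metric (C i).
Qed.

(** The metric recovers [X] from its images: X g is the sum of the X J_i g_i J_i^T, and [g] has a
    smooth inverse. This gives the smoothness of [phi] and [xi], which are known only through their
    images in the cells. *)
Let pulled_smooth p (X : 'rV[R]_m -> 'M[R]_(p, m))
    (Y : 'I_k -> 'rV[R]_m -> 'M[R]_(p, n)) :
  (forall i x, U x -> X x *m J i x = Y i x) -> (forall i, smooth_on U (Y i)) ->
  smooth_on U X.
Proof.
move=> XY YU; apply: (@smooth_on_eq _ _ _ oU _ (fun x =>
  (\sum_i Y i x *m g_ i (F i x) *m (J i x)^T) *m invmx (g x))).
  move=> x Ux; rewrite (_ : \sum_i _ = X x *m g x).
    by rewrite mulmxK //; exact/nondegenerate_unitmx/g_nondeg.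
  by rewrite gE // mulmx_sumr; apply: eq_bigr => i _; rewrite -XY // !mulmxA.
apply: smooth_on_mulmx => //; last first.
  by apply: smooth_on_invmx => // x Ux; exact/nondegenerate_unitmx/g_nondeg.
apply: smooth_on_sum => // i _; apply: smooth_on_mulmx => //; last first.
  exact: smooth_on_trmx.
by apply: smooth_on_mulmx => //; apply: along; exact: contact_metric (C i).
Qed.

(** The identity for phi^2 is checked after applying each [J i x], which suffices by [tangent_inj];
    compatibility with the metric is checked by summing over the cells. *)
Lemma sewn_contact : contact_on U phi xi eta g.
Proof.
split=> //.
- apply: (pulled_smooth phiE) => i; apply: smooth_on_mulmx => //; apply: along.
  exact: contact_phi (C i).
- apply: (pulled_smooth xiE) => i; apply: smooth_onZ => //.
    exact: smooth_on_cst.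
  by apply: along; exact: contact_xi (C i).
- apply: (smooth_on_eq oU (fun x Ux => esym (etaE0 Ux))).
  apply: smooth_onZ => //; first exact: smooth_on_cst.
  by apply: smooth_on_mulmx => //; apply: along; exact: contact_eta (C i0).
- move=> x u Ux; apply/subr0_eq/(tangent_inj Ux) => i.
  rewrite mulmxBl -!mulmxA phiE // !mulmxA -[u *m phi x *m _]mulmxA phiE //.
  rewrite !mulmxA (contact_phi2 (C i) _ (UQ i Ux)) (etaE i) //.
  rewrite mulmxDl mulNmx -scalemxAl xiE // scalerA mulrAC divff // mul1r.
  by rewrite subrr.
- move=> x Ux; rewrite (etaE i0) // xiE // form1Z (contact_eta_xi (C i0) (UQ i0 Ux)).
  by rewrite mulr1 divff.
- move=> x u v Ux; rewrite !form2gE //.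
  (* Each cell subtracts eta(u) eta(v) / s^2, and there are k = s^2 cells. *)
  rewrite (eq_bigr (fun i => form2 (g_ i (F i x)) (u *m J i x) (v *m J i x)
     - s^-1 * form1 (eta x) u * (s^-1 * form1 (eta x) v))); last first.
    move=> i _; rewrite -!mulmxA phiE // !mulmxA (contact_compat (C i) _ _ (UQ i Ux)).
    by rewrite !(etaE i) // !mulKf.
  rewrite big_split /= sumrN sumr_const card_ord; congr (_ - _).
  rewrite -mulr_natr -s2; field; exact: s_neq0.
Qed.

Let near_D (W : normedModType R) (f h : 'rV[R]_m -> W) x z :
  (forall y, U y -> f y = h y) -> U x -> 'D_z f x = 'D_z h x.
Proof. by move=> fh Ux; apply: derive_near oU Ux fh. Qed.

Lemma sewn_eta_closed x u v : U x ->
  (forall y a b, Q i0 y -> ext_d1 (eta_ i0) y a b = 0) -> ext_d1 eta x u v = 0.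
Proof.
move=> Ux closed; have eQ := contact_eta (C i0).
have deta := smooth_on_differentiable eQ (UQ i0 Ux).
have DE z a : 'D_z (fun y => form1 (eta y) a) x =
    s * (form1 (eta_ i0 (F i0 x)) (a *m 'D_z (jacobian (F i0)) x)
      + form1 ('D_(z *m J i0 x) (eta_ i0) (F i0 x)) (a *m J i0 x)).
  have deN := smooth_on_differentiable (contact_eta sewn_contact) Ux.
  rewrite (derive_form1 _ _ deN) (near_D _ etaE0 Ux).
  have [|_ ->] := @derive_scale _ _ _ s (fun y => J i0 y *m eta_ i0 (F i0 y)) x z.
    apply: smooth_on_differentiable Ux; apply: smooth_on_mulmx => //.
    exact: along.
  rewrite -(derive_pullback1 oU (FU i0) (@UQ i0) z a Ux eQ).
  by rewrite /form1 -scalemxAr mxE.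
have := closed _ (u *m J i0 x) (v *m J i0 x) (UQ i0 Ux).
rewrite /ext_d1 !DE !(derive_form1 _ _ deta).
(* The two Hessian terms coincide, so they drop out of the antisymmetrised derivative. *)
rewrite (derive_jacobian_sym oU (FU i0) v u Ux) => d0.
by rewrite -mulrBr opprD addrACA subrr add0r d0 mulr0.
Qed.

(** The matrix of the fundamental form of the i-th cell; the transpose arises because [phi_ i] acts
    on the second argument. *)
Let Omega i y : 'M[R]_n := g_ i y *m (phi_ i y)^T.

Let Omega_smooth i : smooth_on (Q i) (Omega i).
Proof.
apply: smooth_on_mulmx => //; first exact: contact_metric (C i).
by apply: smooth_on_trmx => //; exact: contact_phi (C i).
Qed.

Let fundamentalE x : U x ->
  g x *m (phi x)^T = \sum_i J i x *m Omega i (F i x) *m (J i x)^T.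
Proof.
move=> Ux; rewrite gE // mulmx_suml; apply: eq_bigr => i _.
by rewrite -!mulmxA -!trmx_mul phiE.
Qed.

(* Stated with abstract [T] and [d], the second derivatives of [F] and the
   derivatives of the fundamental forms, to keep the derivatives out of the
   algebraic manipulations. *)
Let D_fundamental x : U x -> exists (T : 'I_k -> 'rV[R]_m -> 'rV[R]_m -> 'rV[R]_n)
    (d : 'I_k -> 'rV[R]_n -> 'rV[R]_n -> 'rV[R]_n -> R),
  [/\ forall i a b, T i a b = T i b a,
      forall i a b c, d i a b c =
        'D_a (fun y => form2 (g_ i y) b (c *m phi_ i y)) (F i x) &
      forall z u v, 'D_z (fun y => form2 (g y) u (v *m phi y)) x =
        \sum_i (form2 (Omega i (F i x)) (T i u z) (v *m J i x)
          + d i (z *m J i x) (u *m J i x) (v *m J i x)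
          + form2 (Omega i (F i x)) (u *m J i x) (T i v z))].
Proof.
move=> Ux; pose K y := \sum_i J i y *m Omega i (F i y) *m (J i y)^T.
exists (fun i a b => a *m 'D_b (jacobian (F i)) x).
exists (fun i a b c => form2 ('D_a (Omega i) (F i x)) b c).
split=> [i a b|i a b c|z u v]; first exact: (derive_jacobian_sym oU (FU i) a b Ux).
  have dO := smooth_on_differentiable (Omega_smooth i) (UQ i Ux).
  rewrite (_ : (fun y => _) = fun y => form2 (Omega i y) b c).
    by rewrite (derive_form2 _ _ _ dO).
  by apply/funext => y; rewrite form2_mulr.
have KE y : U y -> form2 (g y) u (v *m phi y) = form2 (K y) u v.
  by move=> Uy; rewrite -form2_mulr fundamentalE.
have dK i : differentiable (fun y => J i y *m Omega i (F i y) *m (J i y)^T) x.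
  apply: smooth_on_differentiable Ux; apply: smooth_on_mulmx => //.
    by apply: smooth_on_mulmx => //; apply: along.
  exact: smooth_on_trmx.
have [dKs DK] := derive_big_sum z dK.
rewrite (near_D _ KE Ux) (derive_form2 _ _ _ dKs) DK form2_summ.
by apply: eq_bigr => i _; rewrite (derive_pullback2 oU (FU i) (@UQ i)).
Qed.

(** In the cyclic sum the Hessian terms cancel in pairs, by symmetry of [T] and antisymmetry of the
    fundamental forms. The factor 1/s compensates eta = s eta_i in each summand. The value alpha = 0
    covers the almost cosymplectic case. *)
Lemma sewn_fundamental_derivative (alpha : R) x u v w : U x ->
  (forall i y a b c, Q i y ->
    ext_d2 (fun y a b => form2 (g_ i y) a (b *m phi_ i y)) y a b c =
    2 * alpha * wedge12 (form1 (eta_ i y))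
      (fun a b => form2 (g_ i y) a (b *m phi_ i y)) a b c) ->
  ext_d2 (fun y a b => form2 (g y) a (b *m phi y)) x u v w =
  2 * (alpha / s) * wedge12 (form1 (eta x))
    (fun a b => form2 (g x) a (b *m phi x)) u v w.
Proof.
move=> Ux H; have [T [d [TC dE DE]]] := D_fundamental Ux.
rewrite /ext_d2 !DE /wedge12.
have PhiE a b : form2 (g x) a (b *m phi x) =
    \sum_i form2 (Omega i (F i x)) (a *m J i x) (b *m J i x).
  rewrite -form2_mulr fundamentalE // form2_summ.
  by apply: eq_bigr => i _; rewrite form2_pullback.
rewrite !PhiE -!big_split !mulr_sumr -!big_split mulr_sumr.
apply: eq_bigr => i _ /=.
have dH a b c : d i a b c + d i b c a + d i c a b =
    2 * alpha * (form1 (eta_ i (F i x)) a * form2 (Omega i (F i x)) b c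
      + form1 (eta_ i (F i x)) b * form2 (Omega i (F i x)) c a
      + form1 (eta_ i (F i x)) c * form2 (Omega i (F i x)) a b).
  by rewrite !dE; have := H i _ a b c (UQ i Ux); rewrite /wedge12 -!form2_mulr.
have Oanti a b : form2 (Omega i (F i x)) a b = - form2 (Omega i (F i x)) b a.
  by rewrite !form2_mulr (contact_fundamental_antisym (C i) _ _ (UQ i Ux)).
rewrite !(etaE i) // (TC i u w) (TC i v u) (TC i w v).
move: (form2 (Omega i (F i x))) (form1 (eta_ i (F i x))) Oanti dH => O e OC dH.
rewrite (OC (u *m _) (T i _ _)) (OC (v *m _) (T i _ _)) (OC (w *m _) (T i _ _)).
transitivity (d i (u *m J i x) (v *m J i x) (w *m J i x)
  + d i (v *m J i x) (w *m J i x) (u *m J i x)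
  + d i (w *m J i x) (u *m J i x) (v *m J i x)); first by ring.
by rewrite dH; field.
Qed.

Let hessian x : U x -> exists T : 'I_k -> 'rV[R]_m -> 'rV[R]_m -> 'rV[R]_n,
  (forall i a b, T i a b = a *m 'D_b (jacobian (F i)) x) /\
  (forall i a b, T i a b = T i b a).
Proof.
move=> Ux; exists (fun i a b => a *m 'D_b (jacobian (F i)) x); split=> [|i a b].
  by [].
exact: (derive_jacobian_sym oU (FU i) a b Ux).
Qed.

Let gi_nondeg i y : Q i y -> form2_nondegenerate (g_ i y).
Proof. exact: contact_nondegenerate (C i) y. Qed.

Let gi_smooth i := contact_metric (C i).
Let gi_sym i := contact_sym (C i).

(** The Koszul formulas of N and of the cells are compared term by term. As [T i z u] is the
    derivative of [z *m J i] along [u], the formula says that nabla of N is the tangential part of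
    the pulled back connections. *)
Let christoffel_sewn_pairing x T : U x ->
  (forall i a b, T i a b = a *m 'D_b (jacobian (F i)) x) ->
  (forall i a b, T i a b = T i b a) ->
  forall u z w, form2 (g x) (christoffel g x u z) w =
    \sum_i form2 (g_ i (F i x))
      (T i z u + christoffel (g_ i) (F i x) (u *m J i x) (z *m J i x))
      (w *m J i x).
Proof.
move=> Ux TE TC u z w.
have [t [tF tE _ _ _]] := metric_derivative oU g_smooth g_sym g_nondeg Ux.
have /choice[t_ t_P] : forall i,
    exists t : 'rV[R]_n -> 'rV[R]_n -> 'rV[R]_n -> R,
    [/\ forall a b c, form2 ('D_a (g_ i) (F i x)) b c = t a b c,
      (forall a b c, form2 (g_ i (F i x)) (christoffel (g_ i) (F i x) a b) c =
        2^-1 * (t a b c + t b a c - t c a b)) &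
      forall a b c, t a b c = t a c b].
  move=> i; have [ti [tiF tiE _ _ tiC]] :=
    metric_derivative (@oQ i) (gi_smooth i) (@gi_sym i) (@gi_nondeg i) (UQ i Ux).
  by exists ti.
have tS a b c : t a b c = \sum_i (form2 (g_ i (F i x)) (T i b a) (c *m J i x)
    + t_ i (a *m J i x) (b *m J i x) (c *m J i x)
    + form2 (g_ i (F i x)) (b *m J i x) (T i c a)).
  have dg i : differentiable (fun y => J i y *m g_ i (F i y) *m (J i y)^T) x.
    apply: smooth_on_differentiable Ux; apply: smooth_on_mulmx => //.
      by apply: smooth_on_mulmx => //; apply: along.
    exact: smooth_on_trmx.
  have [_ Dg] := derive_big_sum a dg.
  rewrite -tF (near_D _ gE Ux) Dg form2_summ.
  apply: eq_bigr => i _; have [tiF _ _] := t_P i; rewrite -tiF !TE.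
  exact: (derive_pullback2 oU (FU i) (@UQ i)).
rewrite tE !tS -sumrN -!big_split mulr_sumr.
apply: eq_bigr => i _ /=; have [_ tiE _] := t_P i; rewrite form2Dl tiE.
(* Of the six Hessian terms four cancel by symmetry, and the two equal ones left absorb the factor
   1/2. *)
rewrite (TC i u z) (TC i u w) (TC i z w).
have sg a b := gi_sym a b (UQ i Ux).
rewrite (sg (z *m _) (T i _ _)) (sg (u *m _) (T i _ _)).
by field.
Qed.

Let mul_cov x u : U x -> u *m covariant_mx g xi x =
  'D_u xi x + christoffel g x u (xi x).
Proof.
move=> Ux; apply: (mul_covariant_mx oU g_smooth g_sym g_nondeg) => //.
exact: smooth_on_differentiable (contact_xi sewn_contact) Ux.
Qed.

Let mul_covi i y a : Q i y -> a *m covariant_mx (g_ i) (xi_ i) y =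
  'D_a (xi_ i) y + christoffel (g_ i) y a (xi_ i y).
Proof.
move=> Qy; apply: (mul_covariant_mx (@oQ i) (gi_smooth i) (@gi_sym i)) => //.
  exact: gi_nondeg.
exact: smooth_on_differentiable (contact_xi (C i)) Qy.
Qed.

Let christoffeliZr i y a b c : Q i y ->
  christoffel (g_ i) y a (c *: b) = c *: christoffel (g_ i) y a b.
Proof.
move=> Qy.
have CC := christoffelC (@oQ i) (gi_smooth i) (@gi_sym i) (@gi_nondeg i).
have ZE := christoffelZl (@oQ i) (gi_smooth i) (@gi_sym i) (@gi_nondeg i).
exact: etrans (CC _ _ _ Qy) (etrans (ZE _ c b a Qy) (congr1 _ (CC _ _ _ Qy))).
Qed.

(** Differentiates [sewn_xi]: Leibniz rule on the left, chain rule along [F i] on the right. *)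
Lemma derive_xi_sewn i x u : U x ->
  'D_u xi x *m J i x + xi x *m 'D_u (jacobian (F i)) x =
  s^-1 *: 'D_(u *m J i x) (xi_ i) (F i x).
Proof.
move=> Ux; have dxi := smooth_on_differentiable (contact_xi sewn_contact) Ux.
have [_ <-] := derive_mulmx u dxi (dJ i Ux).
have dxii := smooth_on_differentiable (contact_xi (C i)) (UQ i Ux).
have [da Da] := derive_along (FU i) u Ux dxii.
have [_ DZ] := derive_scale s^-1 u da.
exact: etrans (near_D u (xiE i) Ux) (etrans DZ (congr1 _ Da)).
Qed.

Lemma sewn_covariant i x u : U x ->
  u *m covariant_mx g xi x *m J i x =
  s^-1 *: (u *m J i x *m covariant_mx (g_ i) (xi_ i) (F i x)).
Proof.
move=> Ux; have [T [TE TC]] := hessian Ux.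
have pairing := christoffel_sewn_pairing Ux TE TC.
(* The covariant derivatives of the xi_i all have eta_i equal to 0, so they form a family tangent to
   N. It remains to compare pairings with every [w]. *)
have [z zE] : exists z, forall i,
    z *m J i x = u *m J i x *m covariant_mx (g_ i) (xi_ i) (F i x).
  apply: (tangent_surj Ux (a := 0)) => j.
  by rewrite (contact_covariant_eta (C j) _ (UQ j Ux)).
suff -> : u *m covariant_mx g xi x = s^-1 *: z by rewrite -scalemxAl zE.
apply: nondegenerate_inj (g_nondeg Ux) _ => w.
rewrite (mul_cov u Ux) form2Dl pairing form2Zl !form2gE // mulr_sumr -big_split.
apply: eq_bigr => j _ /=.
have DE : 'D_u xi x *m J j x + T j (xi x) u =
    s^-1 *: 'D_(u *m J j x) (xi_ j) (F j x).
  by rewrite TE; exact: derive_xi_sewn.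
rewrite -form2Dl addrA DE (xiE j Ux) (christoffeliZr _ _ _ (UQ j Ux)).
by rewrite -scalerDr form2Zl zE (mul_covi _ (UQ j Ux)).
Qed.

(** [sewn_covariant] is differentiated once more, and the Christoffel terms of N are evaluated by
    the pairing formula; the overall 1/s is the one of [sewn_covariant]. *)
Lemma sewn_curvature x u v w : U x ->
  form2 (g x) (curvature_at g xi x u v) w =
  s^-1 * \sum_i form2 (g_ i (F i x))
    (curvature_at (g_ i) (xi_ i) (F i x) (u *m J i x) (v *m J i x)) (w *m J i x).
Proof.
move=> Ux; have [T [TE TC]] := hessian Ux.
have pairing := christoffel_sewn_pairing Ux TE TC.
pose B := covariant_mx g xi; pose A i := covariant_mx (g_ i) (xi_ i).
have dB : differentiable B x.
  apply: smooth_on_differentiable Ux; apply: smooth_on_covariant_mx => //.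
  exact: contact_xi sewn_contact.
have dA i : differentiable (A i) (F i x).
  apply: smooth_on_differentiable (UQ i Ux); apply: smooth_on_covariant_mx => //.
    exact: gi_nondeg.
  exact: contact_xi (C i).
(* The derivative along [a] of the relation in [sewn_covariant], with [b] held constant. *)
have E i a b : b *m 'D_a B x *m J i x + T i (b *m B x) a = s^-1 *:
    (T i b a *m A i (F i x) + b *m J i x *m 'D_(a *m J i x) (A i) (F i x)).
  have [d1 D1] := derive_mulmxl b a dB; have [_ D2] := derive_mulmx a d1 (dJ i Ux).
  have [d3 D3] := derive_mulmxl b a (dJ i Ux).
  have [d4 D4] := derive_along (FU i) a Ux (dA i).
  have [d5 D5] := derive_mulmx a d3 d4; have [_ D6] := derive_scale s^-1 a d5.
  rewrite !TE -D1 -D4 -D3 -D5 -D6 -D2.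
  by apply: near_D Ux => y Uy; rewrite sewn_covariant.
rewrite /curvature_at -/B.
move: (v *m 'D_u B x) (u *m 'D_v B x) (fun i => E i u v) (fun i => E i v u) => p q Ep Eq.
rewrite !form2Dl !form2Nl !pairing !form2gE // -!sumrN -!big_split mulr_sumr.
apply: eq_bigr => i _ /=.
rewrite -!form2Nl -!form2Dl -form2Zl; congr (form2 _ _ _).
(* The Hessian terms at [v *m B x] and [u *m B x] coming from the pairing are those on the left of
   [E]; the remaining ones, [T i v u *m A i (F i x)] and its mirror image, cancel by symmetry. *)
rewrite !(sewn_covariant i) // !(christoffeliZr _ _ _ (UQ i Ux)) -/(A i).
have {}Ep := Ep i; have {}Eq := Eq i; move: Ep Eq; rewrite (TC i u v).
move: (T i v u *m _) (v *m J i x *m 'D__ _ _) (u *m J i x *m 'D__ _ _) => a b c.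
move: (T i (v *m _) u) (T i (u *m _) v) => d e Ep Eq.
move: (christoffel _ _ _ _) (christoffel _ _ _ _) => G1 G2.
rewrite (canRL (addrK _) Ep) (canRL (addrK _) Eq).
by apply/rowP => l; rewrite !mxE; ring.
Qed.

(** Naturality of the Lie derivative: [F i] relates [phi] to [phi_ i] and [xi] to xi_i / s.
    Differentiating these relations produces Hessian terms which cancel by symmetry. *)
Lemma sewn_half_lie i x u : U x ->
  u *m half_lie_mx xi phi x *m J i x =
  s^-1 *: (u *m J i x *m half_lie_mx (xi_ i) (phi_ i) (F i x)).
Proof.
move=> Ux; have [T [TE TC]] := hessian Ux.
have dphi := smooth_on_differentiable (contact_phi sewn_contact) Ux.
have dphii := smooth_on_differentiable (contact_phi (C i)) (UQ i Ux).
have DxiE a : 'D_a xi x *m J i x + T i (xi x) a =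
    s^-1 *: 'D_(a *m J i x) (xi_ i) (F i x).
  by rewrite TE; exact: derive_xi_sewn.
have DphiE : u *m 'D_(xi x) phi x *m J i x + T i (u *m phi x) (xi x) =
    T i u (xi x) *m phi_ i (F i x)
    + s^-1 *: (u *m J i x *m 'D_(xi_ i (F i x)) (phi_ i) (F i x)).
  have [d1 D1] := derive_mulmxl u (xi x) dphi.
  have [_ D2] := derive_mulmx (xi x) d1 (dJ i Ux).
  have [d3 D3] := derive_mulmxl u (xi x) (dJ i Ux).
  have [d4 D4] := derive_along (FU i) (xi x) Ux dphii.
  have [_ D5] := derive_mulmx (xi x) d3 d4.
  rewrite !TE -D1 -D2 -D3 scalemxAr -(derive_dirZ _ _ dphii) -(xiE i Ux) -D4 -D5.
  by apply: near_D Ux => y Uy; rewrite -!mulmxA phiE.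
rewrite /half_lie_mx -!scalemxAr -!scalemxAl scalerA mulrC -scalerA.
congr (_ *: _); rewrite !mulmxDr !mulmxN !mulmxDl !mulNmx.
rewrite !mulmxA !(mul_jacobian (contact_xi sewn_contact) _ Ux).
rewrite !(mul_jacobian (contact_xi (C i)) _ (UQ i Ux)).
have uphiE : u *m phi x *m J i x = u *m J i x *m phi_ i (F i x).
  by rewrite -!mulmxA phiE.
have := DxiE (u *m phi x); rewrite uphiE => E1.
have -> : 'D_u xi x *m phi x *m J i x = 'D_u xi x *m J i x *m phi_ i (F i x).
  by rewrite -!mulmxA phiE.
rewrite (canRL (addrK _) (DxiE u)) (canRL (addrK _) E1) (canRL (addrK _) DphiE).
rewrite mulmxBl -scalemxAl (TC i (xi x) u) (TC i (xi x) (u *m _)).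
move: (T i u _ *m _) (T i (u *m _) _) ('D__ _ _ *m _) => a b c.
move: ('D__ (xi_ i) _) (u *m J i x *m 'D__ _ _) => d e.
by apply/rowP => l; rewrite !mxE; ring.
Qed.

(** Count of the powers of s: the curvature carries 1/s, and eta_i = eta / s on images. This gives
    kappa / s^2 = kappa / k; in the terms with mu and mu' each h_i on images equals s h, so one
    factor 1/s remains. *)
Lemma sewn_nullity (kappa mu mu' : R) x u v : U x ->
  (forall i y a b, Q i y ->
    curvature_at (g_ i) (xi_ i) y a b =
    nullity_at kappa mu mu' (eta_ i y) (phi_ i y)
      (half_lie_mx (xi_ i) (phi_ i) y) a b) ->
  curvature_at g xi x u v =
  nullity_at (kappa / k%:R) (mu / s) (mu' / s) (eta x) (phi x)
    (half_lie_mx xi phi x) u v.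
Proof.
move=> Ux null; apply: nondegenerate_inj (g_nondeg Ux) _ => w.
rewrite sewn_curvature // form2gE // mulr_sumr; apply: eq_bigr => i _.
rewrite (null i _ _ _ (UQ i Ux)) -form2Zl; congr (form2 _ _ _).
rewrite /nullity_at !mulmxDl -!scalemxAl !mulmxBl -!scalemxAl !(etaE i) //.
rewrite !(sewn_half_lie i _ Ux) -!(mulmxA _ (phi x)) phiE // !mulmxA.
move: (u *m J i x *m _ *m _) (v *m J i x *m _ *m _) => a b.
move: (u *m J i x *m _) (v *m J i x *m _) => c d.
move: (u *m J i x) (v *m J i x) => e f.
by apply/rowP => l; rewrite !mxE -s2; field.
Qed.

End SewnPatch.

(** * Atlases *)

Section Atlases.
Variables (R : realType) (m n : nat) (N : atlas R m) (M : atlas R n).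
Hypothesis mN : manifold N.
Hypothesis oM : forall b, open (@dom R n M b).
Implicit Types (a : chart N) (b c : chart M).

Lemma manifold_paramK a p : dom a p -> param a (coord a p) = p :> N.
Proof. by case: mN => _ _ _ h _ /h[]. Qed.

Lemma manifold_param_continuous a x : patch a x ->
  {for x, continuous (@param R m N a)}.
Proof. by case: mN => _ _ _ h _ [p /h[_ _ +] <-]. Qed.

Lemma manifold_dom_open a : open (@dom R m N a).
Proof. by case: mN => _ _ /(_ a)[]. Qed.

Lemma manifold_patch_open a : open (@patch R m N a).
Proof. by case: mN => _ _ /(_ a)[]. Qed.

Lemma patchP a x : patch a x -> dom a (param a x) /\ coord a (param a x : N) = x.
Proof. by move=> [p ap <-]; rewrite manifold_paramK. Qed.

Lemma dom_patch a p : dom a p -> patch a (coord a p).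
Proof. by exists p. Qed.

Variable F : N -> M.

Lemma local_domP a b x : local_dom F a b x ->
  [/\ patch a x, dom a (param a x), coord a (param a x) = x &
      dom b (F (param a x))].
Proof.
by move=> [p [ap bFp] <-]; split=> //; rewrite ?manifold_paramK //; exists p.
Qed.

Hypothesis sF : smooth_map F.

Lemma local_dom_mem a b p : dom a p -> dom b (F p) -> local_dom F a b (coord a p).
Proof. by move=> ap bFp; exists p. Qed.

Lemma local_dom_open a b : open (local_dom F a b).
Proof.
rewrite openE => _ [p [ap bFp] <-]; have pa := dom_patch ap.
have FM : open_nbhs p (dom a `&` F @^-1` dom b).
  split=> //; apply: openI; first exact: manifold_dom_open.
  by apply: open_comp => // q _; case: sF => + _; apply.
have nW : nbhs (param a (coord a p) : N) (dom a `&` F @^-1` dom b).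
  by rewrite manifold_paramK //; exact: open_nbhs_nbhs.
have npatch : nbhs (coord a p) (@patch R m N a).
  by apply: open_nbhs_nbhs; split=> //; exact: manifold_patch_open.
apply: filterS (filterI npatch (manifold_param_continuous pa nW)).
move=> x [ax [axd bFx]]; have [_ axE] := patchP ax.
by exists (param a x).
Qed.

Lemma local_rep_smooth a b : smooth_on (local_dom F a b) (local_rep F a b).
Proof. by case: sF. Qed.

Lemma local_rep_coord a b p : dom a p ->
  local_rep F a b (coord a p) = coord b (F p).
Proof. by move=> ap; rewrite /local_rep manifold_paramK. Qed.

End Atlases.

Section ChainRule.
Variables (R : realType) (m n : nat) (N : atlas R m) (M : atlas R n).
Hypothesis mN : manifold N.
Hypothesis oM : forall b, open (@dom R n M b).

Lemma smooth_map_id : smooth_map (@idfun N).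
Proof. by split=> [x|]; [exact: cvg_id|case: mN]. Qed.

(** Near the point, the local expression of [F] in the chart [a] is its expression in [b] composed
    with the transition map. *)
Lemma differential_change (F : N -> M) (a b : chart N) (c : chart M) p :
  smooth_map F -> dom a p -> dom b p -> dom c (F p) ->
  differential F a c p = change a b p *m differential F b c p.
Proof.
move=> sF ap bp cFp; have sI := smooth_map_id.
have oN := manifold_dom_open mN.
have dac := smooth_on_differentiable (local_rep_smooth sF a c)
  (local_dom_mem ap cFp).
have dbc := smooth_on_differentiable (local_rep_smooth sF b c)
  (local_dom_mem bp cFp).
have dab := smooth_on_differentiable (local_rep_smooth sI a b)
  (local_dom_mem (F := idfun) ap bp).
apply/row_matrixP => i; rewrite !rowE /differential.
rewrite -(deriveEjacobian _ dac) /change /differential mulmxA.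
have abE : local_rep idfun a b (coord a p) = coord b p.
  by rewrite local_rep_coord.
rewrite -(deriveEjacobian _ dab) -(deriveEjacobian _ dbc) -abE.
rewrite -abE in dbc; rewrite -(derive_comp _ dab dbc).
have o1 : open (local_dom F a c) by exact: local_dom_open.
have o2 : open (local_dom (@idfun N) a b) by exact: local_dom_open.
apply: (derive_near (U := local_dom F a c `&` local_dom idfun a b)).
- exact: openI.
- by split; exists p.
move=> x [/(local_domP mN)[_ ax axE cx] /(local_domP mN)[_ _ _ bx]].
by rewrite /local_rep /= (manifold_paramK mN bx).
Qed.

End ChainRule.

(** * Bump functions on the coordinate space *)

Section BumpFunctions.
Variables (R : realType) (n : nat) (x : 'rV[R]_n) (d : R).
Hypothesis d0 : 0 < d.

(** The Euclidean square of the distance is used because it is smooth; the norm of row vectors is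
    the maximum norm, and the Euclidean ball lies in the ball of that norm. *)
Definition bump (y : 'rV[R]_n) : R :=
  flat 0 (d ^+ 2 - \sum_i (y 0 i - x 0 i) ^+ 2).

Lemma bump_center : bump x != 0.
Proof.
rewrite /bump big1 ?subr0 => [|i _]; last by rewrite subrr expr0n.
by rewrite /flat exprn_gt0 // expr0 mul1r gt_eqF // expR_gt0.
Qed.

Lemma bump_support y : bump y != 0 -> `|x - y| <= d.
Proof.
rewrite /bump /flat; case: ifP => [|_]; last by rewrite eqxx.
rewrite subr_gt0 => lt_d _; rewrite [leLHS]mx_normrE; apply: bigmax_le; first exact: ltW.
move=> [i j] _ /=; rewrite !mxE (ord1 i) -(ler_pXn2r (n := 2)) ?nnegrE ?normr_ge0 ?ltW //.
rewrite -normrX ger0_norm ?sqr_ge0 //; apply: le_lt_trans lt_d.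
rewrite (bigD1 j) //= -sqrrN opprB lerDl sumr_ge0 // => l _; exact: sqr_ge0.
Qed.

Lemma smooth_on_bump (U : set 'rV[R]_n) : open U -> smooth_on U bump.
Proof.
move=> oU; apply: smooth_on_flat => //; apply: smooth_onD => //.
  exact: smooth_on_cst.
have idU : smooth_on U (@idfun 'rV[R]_n).
  move=> [|r]; first by move=> y _; exact: cvg_id.
  split=> [y _|v]; first exact: ex_diff.
  apply: (@Ck_on_eq _ _ _ oU _ _ (fun=> v)) => [y _|]; last exact: Ck_on_cst.
  by rewrite derive_id.
apply: (@smooth_on_eq _ _ _ oU _
  (fun y => -1 * \sum_i ((y 0 i + - x 0 i) * (y 0 i + - x 0 i)))).
  by move=> y _; rewrite mulN1r.
apply: smooth_onM => //; first exact: smooth_on_cst.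
have yU i : smooth_on U (fun y : 'rV[R]_n => y 0 i + - x 0 i).
  apply: smooth_onD => //; last exact: smooth_on_cst.
  exact: ((smooth_on_mxP oU _).1 idU).
by apply: smooth_on_sum => // i _; apply: smooth_onM.
Qed.

End BumpFunctions.

Section VectorFieldExtension.
Variables (R : realType) (n : nat) (M : atlas R n).
Hypothesis mM : manifold M.
Implicit Types (a b c : chart M) (p : M).

Let oM a : open (@dom R n M a).
Proof. exact: manifold_dom_open. Qed.

Let sI : smooth_map (@idfun M).
Proof. exact: smooth_map_id. Qed.

Lemma change_id a p : dom a p -> change a a p = 1%:M.
Proof.
move=> ap; have aap := local_dom_mem (F := @idfun M) (a := a) (b := a) ap ap.
have daa := smooth_on_differentiable (local_rep_smooth sI a a) aap.
have oaa : open (local_dom (@idfun M) a a) by exact: local_dom_open.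
apply/row_matrixP => i; rewrite !rowE mulmx1 /change /differential.
rewrite -(deriveEjacobian _ daa) -[RHS](@derive_id _ _ (coord a p)).
apply: derive_near oaa aap _ => y /(local_domP mM)[ay day ayE _].
by rewrite /local_rep /= ayE.
Qed.

(** The field constantly [u] in the chart [a] is multiplied by a bump function normalised at [x],
    transported to the other charts, and extended by 0. *)
Lemma vector_field_through a x u : patch a x ->
  exists X : field M 1 n, vector_field X /\ X a x = u.
Proof.
move=> ax; have nax : nbhs x (@patch R n M a).
  by apply: open_nbhs_nbhs; split=> //; exact: manifold_patch_open.
have [e /= e0 eP] := (nbhs_ballP _ _).1 nax.
pose d := e / 2; have d0 : 0 < d by rewrite divr_gt0.
pose K := closed_ball_ (fun z : 'rV[R]_n => `|z|) x d.
have KP y : K y -> patch a y.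
  move=> Ky; apply: eP; rewrite -ball_normE; apply: le_lt_trans Ky _.
  by rewrite ltr_pdivrMr // mulr_natr mulr2n ltrDl.
(* The image of a compact ball is closed because M is Hausdorff; this makes the extension by 0
   smooth at points outside [dom a]. *)
pose Z : set M := param a @` K.
have cZ : closed Z.
  apply: compact_closed; first by case: mM => [[]].
  apply: continuous_compact.
    apply: continuous_in_subspaceT => y; rewrite inE => /KP.
    exact: manifold_param_continuous.
  apply: bounded_closed_compact; last exact: closed_closed_ball_.
  exists (`|x| + d); split; first exact: num_real.
  move=> r lt_r y Ky; apply: le_trans (ltW lt_r).
  rewrite -[y](subKr x) (le_trans (ler_normB _ _)) // lerD2l.
  exact: Ky.
pose rho := bump x d.
pose X : field M 1 n := fun b y =>
  if `[< dom a (param b y) >] then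
    rho (coord a (param b y)) *: ((rho x)^-1 *: u *m change a b (param b y))
  else 0.
have XE b p : dom b p -> dom a p ->
    X b (coord b p) = rho (coord a p) *: ((rho x)^-1 *: u *m change a b p).
  by move=> bp ap; rewrite /X manifold_paramK //; case: asboolP.
exists X; split; last first.
  have [axd axE] := patchP mM ax.
  rewrite -[x in X a x]axE XE // axE change_id // mulmx1 scalerA.
  by rewrite divff ?scale1r // bump_center.
split=> [b|b c p bp cp]; last first.
  have [ap|nap] := pselect (dom a p); last first.
    by rewrite /X !manifold_paramK //; case: asboolP => // _; rewrite mul0mx.
  have cE : change a c p = change a b p *m change b c p.
    exact: (differential_change mM oM sI ap bp cp).
  by rewrite (XE c p cp ap) cE (XE b p bp ap) -[RHS]scalemxAl mulmxA.
apply: smooth_on_local => y /(patchP mM)[by_ byE].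
have [ay|nay] := pselect (dom a (param b y)).
  have oB : open (local_dom (@idfun M) b a) by exact: local_dom_open.
  have oA : open (local_dom (@idfun M) a b) by exact: local_dom_open.
  exists (local_dom (@idfun M) b a); split=> //; first by exists (param b y).
  (* [G] is the local expression of the field as a function of the coordinates in [a]; composing it
     with the transition map gives [X b]. *)
  pose G w := rho w *: ((rho x)^-1 *: u *m jacobian (local_rep (@idfun M) a b) w).
  apply: (@smooth_on_eq _ _ _ oB _ (fun z => G (local_rep (@idfun M) b a z))).
    move=> z /(local_domP mM)[_ bz bzE az]; rewrite -[z in RHS]bzE XE //.
  apply: (smooth_on_comp oB (P := local_dom (@idfun M) a b) (g := G)) => //.
  - move=> z /(local_domP mM)[_ bz _ az]; exists (param b z) => //.
  - exact: local_rep_smooth.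
  apply: smooth_onZ => //; first exact: smooth_on_bump.
  apply: smooth_on_mulmx => //; first exact: smooth_on_cst.
  exact: smooth_on_jacobian (local_rep_smooth sI a b).
(* Outside [dom a]: the point is not in [Z], hence has a neighbourhood avoiding [Z], on which the
   bump function kills the field. *)
pose B := (@patch R n M b) `&` (@param R n M b @^-1` ~` Z).
have nB : nbhs y B.
  apply: filterI.
    apply: open_nbhs_nbhs; split; first exact: manifold_patch_open.
    by exists (param b y).
  have yb : patch b y by exists (param b y).
  apply: (manifold_param_continuous mM yb); apply: open_nbhs_nbhs.
  split; first exact: closed_openC.
  move=> [z Kz zE]; apply: nay; rewrite -zE.
  by have [] := patchP mM (KP _ Kz).
exists B°; split=> //; first exact: open_interior.
apply: (@smooth_on_eq _ _ _ (@open_interior _ B) _ (fun=> 0)); last exact: smooth_on_cst.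
move=> z /interior_subset[bz nZ]; rewrite /X; case: asboolP => // az.
suff -> : rho (coord a (param b z)) = 0 by rewrite scale0r.
apply/eqP/negPn/negP => /(bump_support d0) Kz; apply: nZ.
by exists (coord a (param b z)) => //; rewrite manifold_paramK.
Qed.

End VectorFieldExtension.

(** * The nullity condition as an identity between tensors *)

Section Nullity.
Variables (R : realType) (n : nat) (M : atlas R n) (S : contact_data M).
Hypothesis acm : almost_contact_metric S.

Lemma contact_on_patch a :
  contact_on (@patch R n M a) (phi S a) (xi S a) (eta S a) (metric S a).
Proof.
have [mM [[phiS _] [xiS _] [etaS _] [gS _ gsym gpos]] phi2 etaxi compat] := acm.
split=> //; first exact: manifold_patch_open.
- exact: gsym.
- exact: gpos.
- exact: phi2.
- exact: etaxi.
- exact: compat.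
Qed.

(** Both sides depend only on the values of the fields at the point, and any two tangent vectors
    there are values of global fields. *)
Lemma nullity_tensorial kappa mu mu' :
  nullity S kappa mu mu' <->
  forall a x u v, patch a x ->
    curvature_at (metric S a) (xi S a) x u v =
    nullity_at kappa mu mu' (eta S a x) (phi S a x)
      (half_lie_mx (xi S a) (phi S a) x) u v.
Proof.
have mM : manifold M by case: acm.
have tensor a x (X Y : 'rV[R]_n -> 'rV[R]_n) : patch a x ->
    smooth_on (patch a) X -> smooth_on (patch a) Y ->
  curvature (metric S a) X Y (xi S a) x =
    curvature_at (metric S a) (xi S a) x (X x) (Y x) /\
  let e := form1 (eta S a x) in
  let h := half_lie (xi S a) (phi S a) in
  let h' := fun Z => h (app (phi S a) Z) in
  kappa *: (e (Y x) *: X x - e (X x) *: Y x)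
  + mu *: (e (Y x) *: h X x - e (X x) *: h Y x)
  + mu' *: (e (Y x) *: h' X x - e (X x) *: h' Y x) =
  nullity_at kappa mu mu' (eta S a x) (phi S a x)
    (half_lie_mx (xi S a) (phi S a) x) (X x) (Y x).
  move=> ax XS YS; have C := contact_on_patch a.
  have dX := smooth_on_differentiable XS ax.
  have dY := smooth_on_differentiable YS ax.
  have dphi := smooth_on_differentiable (contact_phi C) ax.
  have [dXp _] := derive_mulmx 0 dX dphi; have [dYp _] := derive_mulmx 0 dY dphi.
  split.
    apply: (curvature_tensor (contact_open C) (contact_metric C) (contact_sym C)) => //.
      exact: contact_nondegenerate C.
    exact: contact_xi C.
  by rewrite /= !(half_lie_tensor (contact_xi C) (contact_phi C) ax).
split=> [null a x u v ax|H X Y [XS _] [YS _] a x ax] /=.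
  have [X [XF <-]] := vector_field_through mM u ax.
  have [Y [YF <-]] := vector_field_through mM v ax.
  by have [<- <-] := tensor a x (X a) (Y a) ax (XF.1 a) (YF.1 a); exact: null.
by have [-> ->] := tensor a x (X a) (Y a) ax (XS a) (YS a); exact: H.
Qed.

End Nullity.

(** * Manifolds of sewed cells *)

Section ProductCharts.
Variables (R : realType) (k : nat) (C : 'I_k -> cell R).

Local Notation n := (cells_dim k).
Implicit Types i j : 'I_k.

Lemma mul_dproj p (A : 'M[R]_(p, n)) i : A *m dproj R i = submxrow A i.
Proof.
have {1}-> : A = \mxrow_(j < k) submxrow A j by rewrite submxrowK.
rewrite /dproj mul_mxrow_mxcol (bigD1 i) //= eqxx mulmx1.
by rewrite big1 ?addr0 // => j /negbTE ->; rewrite mulmx0.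
Qed.

Lemma dproj_trmx_mul i j :
  (dproj R i)^T *m dproj R j = if i == j then 1%:M else 0.
Proof.
rewrite mul_dproj /dproj tr_mxcol mxrowK eq_sym.
by case: eqP => _; rewrite ?trmx1 ?trmx0.
Qed.

Lemma sum_dproj p (A : 'I_k -> 'M[R]_(p, 3)) i :
  (\sum_j A j *m (dproj R j)^T) *m dproj R i = A i.
Proof.
rewrite mulmx_suml (bigD1 i) //= -mulmxA dproj_trmx_mul eqxx mulmx1.
rewrite big1 ?addr0 // => j /negbTE ji.
by rewrite -mulmxA dproj_trmx_mul ji mulmx0.
Qed.

(** Each coordinate projection is continuous and there are finitely many of them. This supplies the
    openness of chart domains asked of the target of [iota]. *)
Lemma product_dom_open (c : chart (product_of_cells C)) :
  (forall i, manifold (C i)) -> open (dom c).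
Proof.
move=> mC; rewrite openE => p cp.
have near_i i : \forall q \near p, dom (c i) ((q : product_of_cells C) i).
  have ni : nbhs ((p : product_of_cells C) i) (dom (c i)).
    by apply: open_nbhs_nbhs; split; [exact: manifold_dom_open|exact: cp].
  exact: (@proj_continuous _ (fun i => points (C i)) i p _ ni).
exact: (@filter_forall _ _ _ (nbhs p) (nbhs_filter p) near_i).
Qed.

End ProductCharts.

(** * From the charts of N to the local model, and back to N *)

Section SewedCellsCharts.
Variables (R : realType) (k : nat) (C : 'I_k -> cell R) (N : atlas R (2 * k).+1)
  (iota : N -> product_of_cells C) (S : contact_data N).
Hypothesis hN : sewed_cells iota S.
Variable i0 : 'I_k.
Hypothesis i00 : i0 = 0%N :> nat.
Implicit Types (i j : 'I_k) (a b : chart N) (c : chart (product_of_cells C)).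

Local Notation n := (cells_dim k).
Let s : R := Num.sqrt k%:R.
Let D i : contact_data (C i) := cell_data (C i).

Let acm i : almost_contact_metric (D i).
Proof. by case: hN => /(_ i)[]. Qed.

Let mC i : manifold (C i).
Proof. by case: (acm i). Qed.

Let mN : manifold N.
Proof. by case: hN => _ [[]]. Qed.

Let siota : smooth_map iota.
Proof. by case: hN => _ [[]]. Qed.

Let oM c : open (dom c).
Proof. exact: product_dom_open. Qed.

Let s_gt0 : 0 < s.
Proof. by rewrite sqrtr_gt0 ltr0n (leq_ltn_trans (leq0n i0)). Qed.

Let s_neq0 : s != 0. Proof. by rewrite gt_eqF. Qed.

Let F c a i x : 'rV[R]_3 := submxrow (local_rep iota a c x) i.

Let smooth_rep a c : smooth_on (local_dom iota a c) (local_rep iota a c).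
Proof. exact: local_rep_smooth. Qed.

Let o_dom a c : open (local_dom iota a c).
Proof. exact: local_dom_open. Qed.

Let FU a c i : smooth_on (local_dom iota a c) (F c a i).
Proof.
apply: (@smooth_on_eq _ _ _ (@o_dom a c) _
  (fun x => local_rep iota a c x *m dproj R i)).
  by move=> x _; rewrite mul_dproj.
apply: smooth_on_mulmx => //; exact: smooth_on_cst.
Qed.

Let jacobianF a c i x : local_dom iota a c x ->
  jacobian (F c a i) x = jacobian (local_rep iota a c) x *m dproj R i.
Proof.
move=> Ux; have dr := smooth_on_differentiable (@smooth_rep a c) Ux.
apply/row_matrixP => j; rewrite !rowE mulmxA.
rewrite -(deriveEjacobian _ (smooth_on_differentiable (@FU a c i) Ux)).
rewrite -(deriveEjacobian _ dr).
have [_ <-] := derive_mulmxr (dproj R i) (delta_mx 0 j) dr.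
by apply: derive_near (@o_dom a c) Ux _ => y _; rewrite mul_dproj.
Qed.

Let f_bar_dproj c y i :
  f_bar c y *m dproj R i = dproj R i *m phi (D i) (c i) (submxrow y i).
Proof.
exact: (sum_dproj (fun j => dproj R j *m phi (D j) (c j) (submxrow y j))).
Qed.

Let xi_bar_dproj c y i :
  xi_bar c y *m dproj R i = s^-1 *: xi (D i) (c i) (submxrow y i).
Proof.
rewrite /xi_bar -scalemxAl; congr (_ *: _).
exact: (sum_dproj (fun j => xi (D j) (c j) (submxrow y j))).
Qed.

(** The relations for the tensors are those of [restricted_structure] projected by [dproj R i]; the
    tangent conditions hold because the differential of [iota] is injective with image that of
    [f_bar] plus the line of [xi_bar]. *)
Lemma sewn_chart a c :
  sewn_patch i0 s (local_dom iota a c) (fun i => patch (c i)) (F c a)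
    (fun i => phi (D i) (c i)) (fun i => metric (D i) (c i))
    (fun i => xi (D i) (c i)) (fun i => eta (D i) (c i))
    (phi S a) (metric S a) (xi S a) (eta S a).
Proof.
have chart_of x : local_dom iota a c x -> exists p : N,
    [/\ dom a p, dom c (iota p) & coord a p = x].
  by move=> [p [ap cp] <-]; exists p.
have [_ [[_ _ _ _ tangent] _] structure] := hN.
have CP i := contact_on_patch (acm i) (c i).
have FE p i : dom a p -> submxrow (coord c (iota p)) i = F c a i (coord a p).
  by move=> ap; rewrite /F local_rep_coord.
have FP p i : dom a p -> dom c (iota p) -> patch (c i) (F c a i (coord a p)).
  move=> ap cp; rewrite -FE // /product_of_cells /= mxrowK.
  by exists (iota p i) => //; exact: cp.
have JE p i : dom a p -> dom c (iota p) ->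
    jacobian (F c a i) (coord a p) = differential iota a c p *m dproj R i.
  by move=> ap cp; rewrite jacobianF //; exists p.
split.
- exact: s_gt0.
- by rewrite sqr_sqrtr.
- exact: o_dom.
- by move=> i; exact: FU.
- by move=> i x /chart_of[p [ap cp <-]]; exact: FP.
- exact: CP.
- move=> i x /chart_of[p [ap cp <-]]; have [phiE _ _ _] := structure a c p ap cp.
  by rewrite JE // mulmxA phiE -!mulmxA f_bar_dproj FE.
- move=> i x /chart_of[p [ap cp <-]]; have [_ xiE _ _] := structure a c p ap cp.
  by rewrite JE // mulmxA xiE xi_bar_dproj FE.
- move=> x /chart_of[p [ap cp <-]]; have [_ _ etaE _] := structure a c p ap cp.
  by rewrite JE // (etaE i0 i00) /eta_bar mulmxA FE.
- move=> x /chart_of[p [ap cp <-]]; have [_ _ _ gE] := structure a c p ap cp.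
  rewrite gE /g_bar mulmx_sumr mulmx_suml; apply: eq_bigr => i _.
  by rewrite JE // trmx_mul !mulmxA FE.
- move=> i x u /chart_of[p [ap cp <-]].
  have [_ /eqmxP tE] := tangent a c p ap cp.
  have : (u *m differential iota a c p <= sewing_distribution c (coord c (iota p)))%MS.
    by rewrite -tE submxMl.
  (* A tangent vector is v f + w xi_bar; eta_j vanishes on the image of phi_j, so its value is w / s
     whatever [j] is. *)
  move=> /sub_addsmxP[[v w] /= uE].
  suff etaE j : form1 (eta (D j) (c j) (F c a j (coord a p)))
      (u *m jacobian (F c a j) (coord a p)) = w 0 0 * s^-1.
    by rewrite (etaE i) (etaE i0).
  rewrite JE // mulmxA uE mulmxDl -!mulmxA f_bar_dproj xi_bar_dproj FE //.
  rewrite mulmxA (mx11_scalar w) mul_scalar_mx form1D !form1Z.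
  rewrite (contact_eta_phi (CP j) _ (FP p j ap cp)) add0r.
  by rewrite (contact_eta_xi (CP j) (FP p j ap cp)) mulr1 mxE.
- move=> x u /chart_of[p [ap cp <-]] u0.
  have [/row_free_inj fr _] := tangent a c p ap cp.
  apply: fr; rewrite mul0mx.
  rewrite -[LHS](@submxrowK _ _ (fun=> 3%N)) -[RHS](@submxrowK _ _ (fun=> 3%N)).
  by apply: eq_mxrow => i; rewrite submxrow0 -mul_dproj -mulmxA -JE.
- move=> x z e /chart_of[p [ap cp <-]] ze.
  have [_ /eqmxP tE] := tangent a c p ap cp.
  (* As -phi_i^2 z_i = z_i - e xi_i, the vector with components z_i is the image under f of -(phi_i
     z_i), plus s e xi_bar. *)
  pose v : 'rV[R]_n :=
    \sum_i (z i *m phi (D i) (c i) (F c a i (coord a p))) *m (dproj R i)^T.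
  pose w := - v *m f_bar c (coord c (iota p)) + (s * e) *: xi_bar c (coord c (iota p)).
  have : (w <= differential iota a c p)%MS.
    rewrite tE /w -mul_scalar_mx; apply/sub_addsmxP.
    by exists (- v, (s * e)%:M).
  move=> /submxP[t tw]; exists t => i.
  rewrite JE // mulmxA -tw mulmxDl -mulmxA f_bar_dproj -scalemxAl xi_bar_dproj.
  rewrite FE // mulmxA mulNmx sum_dproj mulNmx.
  rewrite (contact_phi2 (CP i) _ (FP p i ap cp)) ze scalerA -mulrA mulrCA divff //.
  by rewrite mulr1 opprD opprK addrNK.
Qed.

Lemma sewn_chart_at a x : patch a x -> exists c, local_dom iota a c x.
Proof.
move=> [p ap <-].
have cover i : exists e : chart (C i), dom e (iota p i).
  by case: (mC i) => _ /(_ (iota p i)).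
exists (fun i => sval (cid (cover i))); exists p => //; split=> // i.
exact: svalP (cid (cover i)).
Qed.

Let contact_at a x : patch a x -> exists2 U, U x &
  contact_on U (phi S a) (xi S a) (eta S a) (metric S a).
Proof.
move=> /sewn_chart_at[c cx]; exists (local_dom iota a c) => //.
exact: sewn_contact (sewn_chart a c).
Qed.

Let smooth_at p q (T : field N p q) :
  (forall a x, patch a x ->
    exists U, [/\ open U, U x & smooth_on U (T a)]) -> smooth_field T.
Proof. by move=> h a; apply: smooth_on_local => x /h. Qed.

Lemma sewed_almost_contact_metric : almost_contact_metric S.
Proof.
have [_ [[_ _ _ _ tangent] _] structure] := hN.
(* The charts [a] and [b] are compared through one product chart [c] at [iota p]; for [phi] and
   [xi], the transformation law follows by cancelling the injective differential of [iota] in the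
   charts [b] and [c]. *)
have common a b p : dom a p -> dom b p -> exists c,
    [/\ row_free (differential iota b c p),
        differential iota a c p = change a b p *m differential iota b c p &
        dom c (iota p)].
  move=> ap bp; have [c [q [aq cq] qE]] := sewn_chart_at (dom_patch ap).
  have cp : dom c (iota p).
    by rewrite -(manifold_paramK mN ap) -qE (manifold_paramK mN aq).
  exists c; split=> //; first by have [] := tangent b c p bp cp.
  exact: differential_change.
split=> //.
- split.
  + split=> [|a b p ap bp].
      apply: smooth_at => a x /contact_at[U Ux CU]; exists U.
      by split=> //; [exact: contact_open CU|exact: contact_phi CU].
    have [c [/row_free_inj fr JE cp]] := common a b p ap bp.
    have [phia _ _ _] := structure a c p ap cp.
    have [phib _ _ _] := structure b c p bp cp.
    move: (differential iota b c p) (differential iota a c p) (change a b p)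
      fr JE phia phib => Jb Ja ch fr JE phia phib.
    by apply: fr; rewrite /= -!mulmxA -JE phia phib mulmxA -JE.
  + split=> [|a b p ap bp].
      apply: smooth_at => a x /contact_at[U Ux CU]; exists U.
      by split=> //; [exact: contact_open CU|exact: contact_xi CU].
    have [c [/row_free_inj fr JE cp]] := common a b p ap bp.
    have [_ xia _ _] := structure a c p ap cp.
    have [_ xib _ _] := structure b c p bp cp.
    move: (differential iota b c p) (differential iota a c p) (change a b p)
      fr JE xia xib => Jb Ja ch fr JE xia xib.
    by apply: fr; rewrite /= -mulmxA -JE xia xib.
  + split=> [|a b p ap bp].
      apply: smooth_at => a x /contact_at[U Ux CU]; exists U.
      by split=> //; [exact: contact_open CU|exact: contact_eta CU].
    have [c [_ JE cp]] := common a b p ap bp.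
    have [_ _ etaa _] := structure a c p ap cp.
    have [_ _ etab _] := structure b c p bp cp.
    by rewrite (etaa i0 i00) (etab i0 i00) JE -scalemxAr !mulmxA.
  + split=> [|a b p ap bp|a x u v|a x u].
    * apply: smooth_at => a x /contact_at[U Ux CU]; exists U.
      by split=> //; [exact: contact_open CU|exact: contact_metric CU].
    * have [c [_ JE cp]] := common a b p ap bp.
      have [_ _ _ ga] := structure a c p ap cp.
      have [_ _ _ gb] := structure b c p bp cp.
      by rewrite ga gb JE trmx_mul !mulmxA.
    * by move=> /contact_at[U Ux CU]; exact: contact_sym CU _ _ _ Ux.
    * by move=> /contact_at[U Ux CU]; exact: contact_pos CU _ _ Ux.
- by move=> a x u /contact_at[U Ux CU]; exact: contact_phi2 CU _ _ Ux.
- by move=> a x /contact_at[U Ux CU]; exact: contact_eta_xi CU _ Ux.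
- by move=> a x u v /contact_at[U Ux CU]; exact: contact_compat CU _ _ _ Ux.
Qed.

Lemma sewed_eta_closed : eta_closed S.
Proof.
move=> a x u v /sewn_chart_at[c cx].
apply: (sewn_eta_closed (sewn_chart a c) u v cx) => y u' v' Py.
by have [/(_ i0)[_ closed] _ _] := hN; exact: closed.
Qed.

Lemma sewed_fundamental_derivative (alpha : R) :
  (forall i (e : chart (C i)) y u v w, patch e y ->
    ext_d2 (fundamental_form (D i) e) y u v w =
    2 * alpha *
      wedge12 (form1 (eta (D i) e y)) (fundamental_form (D i) e y) u v w) ->
  forall a x u v w, patch a x -> ext_d2 (fundamental_form S a) x u v w =
    2 * (alpha / s) *
      wedge12 (form1 (eta S a x)) (fundamental_form S a x) u v w.
Proof.
move=> H a x u v w /sewn_chart_at[c cx].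
apply: (sewn_fundamental_derivative (sewn_chart a c) u v w cx) => i y u' v' w' Py.
exact: H.
Qed.

Lemma sewed_nullity kappa mu mu' :
  (forall i, nullity (D i) kappa mu mu') ->
  nullity S (kappa / k%:R) (mu / s) (mu' / s).
Proof.
move=> null; apply/(nullity_tensorial sewed_almost_contact_metric).
move=> a x u v /sewn_chart_at[c cx].
apply: (sewn_nullity (sewn_chart a c) u v cx) => i y u' v' Py.
by have /(nullity_tensorial (acm i)) := null i; apply.
Qed.

End SewedCellsCharts.

Theorem theorem4 (R : realType) (k : nat) (hk : (2 <= k)%N) (M3 : cell R)
  (N : atlas R (2 * k).+1)
  (iota : N -> product_of_cells (fun _ : 'I_k => M3)) (S : contact_data N)
  (hN : sewed_cells iota S)
  (kappa0 mu0 mu0' : R)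
  (hnull : nullity (cell_data M3) kappa0 mu0 mu0') :
  (almost_cosymplectic (cell_data M3) ->
     almost_cosymplectic S /\
     nullity S (kappa0 / k%:R) (mu0 / Num.sqrt k%:R) (mu0' / Num.sqrt k%:R)) /\
  (forall alpha : R, almost_kenmotsu (cell_data M3) alpha ->
     almost_kenmotsu S (alpha / Num.sqrt k%:R) /\
     nullity S (kappa0 / k%:R) (mu0 / Num.sqrt k%:R) (mu0' / Num.sqrt k%:R)).
Proof.
have k_gt0 : (0 < k)%N by exact: leq_trans hk.
pose i0 := Ordinal k_gt0.
have acm := sewed_almost_contact_metric hN (erefl : i0 = 0%N :> nat).
have closed := sewed_eta_closed hN (erefl : i0 = 0%N :> nat).
have null := sewed_nullity hN (erefl : i0 = 0%N :> nat) (fun=> hnull).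
have dPhi alpha := @sewed_fundamental_derivative _ _ _ _ _ _ hN i0 erefl alpha.
split=> [[_ _ cosym]|alpha [alpha0 _ _ kenm]]; split=> //; split=> //.
(* The almost cosymplectic condition on d Phi is the case alpha = 0 of the Kenmotsu one. *)
- move=> a x u v w ax; rewrite (dPhi 0) //; first by rewrite mul0r mulr0 mul0r.
  by move=> i b y u' v' w' by_; rewrite cosym // mulr0 mul0r.
- by rewrite mulf_neq0 // invr_neq0 // gt_eqF // sqrtr_gt0 ltr0n.
- by apply: dPhi => i; exact: kenm.
Qed.
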